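(* Let $X=\bigvee_{n\in\mathbb{N}}\mathbb{R}$ be the bouquet of countably many copies of $\mathbb{R}$ equipped with the quotient diffeology, and let $0\in X$ be the wedge point. Let $\hat{T}_0(X)$ denote the external tangent space of $X$ at $0$ (smooth derivations of the germ algebra) and let $\hat{T}^R_0(X)$ denote the right tangent space of $X$ at $0$ (all derivations of the germ algebra). Then there are isomorphisms of real vector spaces $$\hat{T}_0(X)\cong\bigoplus_{n\in\mathbb{N}}\mathbb{R},\qquad \hat{T}^R_0(X)\cong \mathrm{Hom}_{\mathbb{R}}\Bigl(\prod_{n\in\mathbb{N}}\mathbb{R},\ \mathbb{R}\Bigr),$$ where $\mathrm{Hom}_{\mathbb{R}}$ denotes the space of all $\mathbb{R}$-linear maps. In particular, $$\dim_{\mathbb{R}}\hat{T}_0(X)=\aleph_0\qquad\text{and}\qquad \dim_{\mathbb{R}}\hat{T}^R_0(X)>\aleph_0.$$ Hence the external and right tangent spaces do not coincide, i.e. $\hat{T}_0(X)\neq\hat{T}^R_0(X)$.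
   Context: $\mathbb{N}$ denotes the set of positive integers. Diffeological spaces. A parametrization of a set $X$ is a map $U\to X$ with $U$ an open subset of $\mathbb{R}^n$ for some $n\in\mathbb{Z}_{\ge 0}$. A diffeology on $X$ is a set of parametrizations of $X$, called plots, such that: (Covering) every constant parametrization is a plot; (Locality) if $p\colon U\to X$ is a parametrization and $U$ has an open covering $\{U_\alpha\}$ with every $p|_{U_\alpha}$ a plot, then $p$ is a plot; (Smooth compatibility) if $p\colon U\to X$ is a plot, $V\subset\mathbb{R}^m$ is open and $f\colon V\to U$ is smooth in the usual sense, then $p\circ f$ is a plot. A diffeological space is a set equipped with a diffeology. A map $f\colon X\to Y$ between diffeological spaces is smooth if $f\circ p$ is a plot of $Y$ for every plot $p$ of $X$. A smooth manifold (in particular $\mathbb{R}$) carries the standard diffeology, whose plots are the smooth maps, in the usual sense, from Euclidean open sets. Constructions. - $D$-topology on $X$: the finest topology making all plots of $X$ continuous. - Subset diffeology on $B\subset X$: plots are the parametrizations of $B$ which are plots of $X$ when composed with the inclusion. - Product diffeology on $\prod_\alpha X_\alpha$: plots are the parametrizations all of whose components are plots of the $X_\alpha$. - Coproduct diffeology on $\bigsqcup_{i\in I}X_i$: $p\colon U\to\bigsqcup_i X_i$ is a plot iff every $u\in U$ has a neighborhood $U'$ and an index $i$ such that $p(U')\subset X_i$ and $p|_{U'}$ is a plot of $X_i$. - Quotient diffeology on $X/{\sim}$, with quotient map $\pi\colon X\to X/{\sim}$: $p\colon U\to X/{\sim}$ is a plot iff every point of $U$ has a neighborhood $U'$ such that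 $p|_{U'}=\pi\circ q$ for some plot $q\colon U'\to X$. - Functional diffeology on the set $C^\infty(X,Y)$ of smooth maps: $p\colon U\to C^\infty(X,Y)$ is a plot iff the map $U\times X\to Y$, $(u,x)\mapsto p(u)(x)$, is smooth, where $U\times X$ has the product diffeology. Bouquet. Let $\{\mathbb{R}_n\}_{n\in\mathbb{N}}$ be countably many copies of $\mathbb{R}$, with $0_n\in\mathbb{R}_n$ the origin. Then $\bigvee_{n\in\mathbb{N}}\mathbb{R}=\bigl(\bigsqcup_{n\in\mathbb{N}}\mathbb{R}_n\bigr)/(0_n\sim 0_m\text{ for all }n,m)$, with the quotient diffeology induced from the coproduct diffeology. The wedge point $0$ is the common class of the $0_n$. Germ algebra. For a diffeological space $X$ and $x\in X$, $G(X,x)=\operatorname{colim}_{x\in B\subset X}C^\infty(B,\mathbb{R})$, the colimit being over all $D$-open neighborhoods $B$ of $x$ (with the subset diffeology) along restriction maps; it is the set of germs at $x$ of smooth real-valued functions. It carries the quotient diffeology induced from the coproduct of the functional diffeologies on the spaces $C^\infty(B,\mathbb{R})$, and is an $\mathbb{R}$-algebra under pointwise operations. Tangent spaces. A right tangent vector at $x$ is an $\mathbb{R}$-linear map $D\colon G(X,x)\to\mathbb{R}$ satisfying the Leibniz rule $D(gh)=g(x)D(h)+h(x)D(g)$ for all $g,h\in G(X,x)$. The right tangent space $\hat{T}^R_x(X)$ is the real vector space of all right tangent vectors at $x$. The external tangent space $\hat{T}_x(X)\subset\hat{T}^R_x(X)$ is the subspace of those $D$ which are smooth as maps of diffeological spaces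 $G(X,x)\to\mathbb{R}$. *)

(* Defs.v *)
From HB Require Import structures.
From mathcomp Require Import all_boot all_order all_algebra.
From mathcomp Require Import generic_quotient.
From mathcomp Require Import all_classical all_reals all_analysis.

Set Implicit Arguments.
Unset Strict Implicit.
Unset Printing Implicit Defensive.

Import Order.TTheory GRing.Theory Num.Theory.
Import numFieldNormedType.Exports.

Local Open Scope quotient_scope.
Local Open Scope classical_set_scope.
Local Open Scope card_scope.
Local Open Scope ring_scope.

Section EuclideanSmoothness.
Variable R : realType.

(* [f] is [k] times (Frechet) differentiable at every point of [U]; the second
   conjunct says so of the components of the differential of [f], that is, of
   its partial derivatives. *)
Fixpoint kdiff m (U : set 'rV[R]_m) (k : nat) (f : 'rV[R]_m -> R) : Prop :=
  if k is k'.+1 then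
    (forall x, U x -> differentiable f x) /\
    (forall i : 'I_m, kdiff U k' (fun x => 'D_(delta_mx 0 i) f x))
  else True.

Definition smooth_on m (U : set 'rV[R]_m) (f : 'rV[R]_m -> R) : Prop :=
  forall k, kdiff U k f.

(* Differentiability is stated in the library for total functions; for [U] open
   it does not depend on the values of the extension [F] outside [U]. *)
Definition smooth_fct m (U : set 'rV[R]_m) (f : U -> R) : Prop :=
  exists2 F : 'rV[R]_m -> R, smooth_on U F & forall u : U, f u = F (\val u).

Definition smooth_vect m n (U : set 'rV[R]_m) (f : U -> 'rV[R]_n) : Prop :=
  forall j : 'I_n, smooth_fct (fun u => f u 0 j).

Lemma differentiable_near0 m (h : 'rV[R]_m -> R) x :
  (\forall z \near x, h z = 0) -> differentiable h x.
Proof.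
move=> h0; have hx0 : h x = 0 by exact: nbhs_singleton h0.
pose z0 : {linear 'rV[R]_m -> R} := \0.
have z0c : continuous z0 by move=> y; exact: cst_continuous.
have E : h \o shift x = cst (h x) + z0 +o_ 0 id.
  apply/eqaddoP => e e0; near=> y.
  have -> : (h \o shift x - (cst (h x) + z0)) y = h (y + x).
    by rewrite !fctE /= hx0 !addr0 subr0.
  have -> : h (y + x) = 0.
    by near: y; move: h0; rewrite (near_shift 0) /= subr0.
  by rewrite normr0 mulr_ge0 // ltW.
apply/diff_locallyP.
by rewrite (diff_unique z0c E); split.
Unshelve. all: by end_near. Qed.

Lemma near_differentiable m (f g : 'rV[R]_m -> R) x :
  (\forall z \near x, f z = g z) -> differentiable f x -> differentiable g x.
Proof.
move=> fg df; have -> : g = f + (g - f) by rewrite addrC subrK.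
apply: differentiableD => //; apply: differentiable_near0.
by apply: filterS fg => z /= fgz; rewrite !fctE fgz subrr.
Qed.

Lemma kdiff_eq m (U : set 'rV[R]_m) k (f g : 'rV[R]_m -> R) : open U ->
  (forall x, U x -> f x = g x) -> kdiff U k f -> kdiff U k g.
Proof.
move=> oU; elim: k f g => [//|k IH] f g fg [df Df].
have nfg x : U x -> \forall z \near x, f z = g z.
  by move=> Ux; have := open_nbhs_nbhs (conj oU Ux); apply: filterS.
split=> [x Ux|i]; first exact: near_differentiable (nfg x Ux) (df x Ux).
by apply: IH (Df i) => x Ux; apply: near_eq_derive; exact: nfg.
Qed.

Lemma kdiff_sub m (U V : set 'rV[R]_m) k (f : 'rV[R]_m -> R) :
  V `<=` U -> kdiff U k f -> kdiff V k f.
Proof.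
move=> VU; elim: k f => [//|k IH] f [df Df]; split=> [x /VU|i]; first exact: df.
exact: IH (Df i).
Qed.

Lemma kdiffW m (U : set 'rV[R]_m) k (f : 'rV[R]_m -> R) :
  kdiff U k.+1 f -> kdiff U k f.
Proof.
elim: k f => [//|k IH] f [df Df]; split=> // i; exact: IH (Df i).
Qed.

Lemma kdiff_cst m (U : set 'rV[R]_m) k (c : R) : open U -> kdiff U k (cst c).
Proof.
move=> oU; elim: k c => [//|k IH] c; split=> [x Ux|i].
  exact: differentiable_cst.
by apply: kdiff_eq (IH 0) => // x Ux; rewrite derive_cst.
Qed.

Lemma kdiffD m (U : set 'rV[R]_m) k (f g : 'rV[R]_m -> R) : open U ->
  kdiff U k f -> kdiff U k g -> kdiff U k (fun x => f x + g x).
Proof.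
move=> oU; elim: k f g => [//|k IH] f g [df Df] [dg Dg].
split=> [x Ux|i]; first by apply: differentiableD; [exact: df|exact: dg].
apply: kdiff_eq (IH _ _ (Df i) (Dg i)) => // x Ux.
by rewrite deriveD //; apply: diff_derivable; [exact: df|exact: dg].
Qed.

Lemma kdiffM m (U : set 'rV[R]_m) k (f g : 'rV[R]_m -> R) : open U ->
  kdiff U k f -> kdiff U k g -> kdiff U k (fun x => f x * g x).
Proof.
move=> oU; elim: k f g => [//|k IH] f g Hf Hg.
have [df Df] := Hf; have [dg Dg] := Hg.
split=> [x Ux|i]; first by apply: differentiableM; [exact: df|exact: dg].
have H1 := IH _ _ (kdiffW Hf) (Dg i).
have H2 := IH _ _ (kdiffW Hg) (Df i).
apply: kdiff_eq (kdiffD oU H1 H2) => // x Ux.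
by rewrite deriveM //; apply: diff_derivable; [exact: df|exact: dg].
Qed.

Lemma kdiff_sum m (U : set 'rV[R]_m) k n (f : 'I_n -> 'rV[R]_m -> R) : open U ->
  (forall j, kdiff U k (f j)) -> kdiff U k (fun x => \sum_(j < n) f j x).
Proof.
move=> oU fk.
have -> : (fun x => \sum_(j < n) f j x) = \sum_(j < n) f j by rewrite fct_sumE.
elim/big_ind : _ => // [|g h kg kh]; first exact: (kdiff_cst k 0 oU).
exact: (kdiffD oU kg kh).
Qed.

Lemma kdiff_coord m (U : set 'rV[R]_m) k (j : 'I_m) : open U ->
  kdiff U k (fun x => x 0 j).
Proof.
move=> oU; case: k => [//|k]; split=> [x Ux|i].
  exact: differentiable_coord.
apply: kdiff_eq (kdiff_cst k ((delta_mx 0 i : 'rV[R]_m) 0 j) oU) => // x Ux.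
rewrite deriveE; last exact: differentiable_coord.
have @f : {linear 'rV[R]_m -> R}.
  by exists (fun N : 'rV[R]_m => N 0 j); do 2![eexists]; do ?[constructor];
     rewrite ?mxE// => ? *; rewrite ?mxE//; move=> ?; rewrite !mxE.
have -> : (fun N : 'rV[R]_m => N 0 j) = f by [].
by rewrite diff_lin //; exact: coord_continuous.
Qed.

Lemma differentiable_vect m n (F : 'rV[R]_m -> 'rV[R]_n) x :
  (forall j, differentiable (fun y => F y 0 j) x) -> differentiable F x.
Proof.
move=> dF.
have -> : F = \sum_(j < n) (fun y => F y 0 j *: (delta_mx 0 j : 'rV[R]_n)).
  by rewrite fct_sumE; apply/funext => y; exact: row_sum_delta.
by apply: differentiable_sum => j; exact: differentiableZl.
Qed.

Lemma derive_vect m n (F : 'rV[R]_m -> 'rV[R]_n) x v j : differentiable F x ->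
  ('d F x v) 0 j = 'D_v (fun y => F y 0 j) x.
Proof.
move=> dF.
have @f : {linear 'rV[R]_n -> R}.
  by exists (fun N : 'rV[R]_n => N 0 j); do 2![eexists]; do ?[constructor];
     rewrite ?mxE// => ? *; rewrite ?mxE//; move=> ?; rewrite !mxE.
have fc : continuous f by exact: coord_continuous.
have df y : differentiable f y by exact: linear_differentiable.
have -> : (fun y => F y 0 j) = f \o F by [].
rewrite (deriveE v (differentiable_comp dF (df (F x)))).
rewrite (diff_comp dF (df (F x))).
by have /(congr1 (@^~ ('d F x v))) /= <- := diff_lin (F x) fc.
Qed.

Lemma kdiff_comp m n (U : set 'rV[R]_m) (V : set 'rV[R]_n) k
    (F : 'rV[R]_m -> 'rV[R]_n) (g : 'rV[R]_n -> R) : open U ->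
  (forall x, U x -> V (F x)) -> (forall j, kdiff U k (fun x => F x 0 j)) ->
  kdiff V k g -> kdiff U k (g \o F).
Proof.
move=> oU FUV; elim: k g => [//|k IH] g kF [dg Dg].
have dF x : U x -> differentiable F x.
  by move=> Ux; apply: differentiable_vect => j; exact: (kF j).1.
split=> [x Ux|i].
  by apply: differentiable_comp; [exact: dF|exact/dg/FUV].
have kF' j : kdiff U k (fun x => F x 0 j) by exact: kdiffW.
have H j := kdiffM oU ((kF j).2 i) (IH _ kF' (Dg j)).
apply: kdiff_eq (kdiff_sum oU H) => // x Ux /=.
have dFx := dF _ Ux; have dgx := dg _ (FUV _ Ux).
rewrite deriveE; last exact: differentiable_comp.
rewrite diff_comp //= [X in 'd g (F x) X]row_sum_delta linear_sum.
apply: eq_bigr => j _.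
by rewrite linearZ /= derive_vect // -deriveE.
Qed.

End EuclideanSmoothness.

Section Diffeologies.
Variable R : realType.

Definition subincl (T : Type) (A B : set T) (AB : A `<=` B) (x : A) : B :=
  SigSub (mem_set (AB _ (set_valP x))).

(* Parametrizations are dependent functions on the subtype associated with [U],
   so that the parametrizations with empty domain of an empty space exist. *)
Record diffeology (X : Type) := Diffeology {
  plot : forall n (U : set 'rV[R]_n), (U -> X) -> Prop;
  plot_open : forall n (U : set 'rV[R]_n) (p : U -> X), plot p -> open U;
  plot_cst : forall n (U : set 'rV[R]_n) (x : X), open U ->
    plot (fun _ : U => x);
  plot_local : forall n (U : set 'rV[R]_n) (p : U -> X)
    (I : Type) (V : I -> set 'rV[R]_n) (VU : forall i, V i `<=` U),
    open U -> (forall i, open (V i)) -> U `<=` \bigcup_i V i ->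
    (forall i, plot (p \o subincl (VU i))) -> plot p;
  plot_comp : forall m n (V : set 'rV[R]_m) (U : set 'rV[R]_n) (p : U -> X)
    (f : V -> U), open V -> plot p -> smooth_vect (fun v => \val (f v)) ->
    plot (p \o f)
}.

Record diffSpace := DiffSpace {
  carrier :> Type;
  diffeology_of : diffeology carrier
}.

Definition is_plot (X : diffSpace) n (U : set 'rV[R]_n) (p : U -> X) : Prop :=
  plot (diffeology_of X) p.

Definition smooth (X Y : diffSpace) (f : X -> Y) : Prop :=
  forall n (U : set 'rV[R]_n) (p : U -> X), is_plot p -> is_plot (f \o p).

(* Domains of plots being open in R^n, continuity of the plots for the finest
   topology making them continuous amounts to this. *)
Definition D_open (X : diffSpace) (A : set X) : Prop :=
  forall n (U : set 'rV[R]_n) (p : U -> X), is_plot p ->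
    open [set x | exists2 u : U, \val u = x & A (p u)].

Lemma smooth_fct_cst m (U : set 'rV[R]_m) (c : R) : open U ->
  smooth_fct (fun _ : U => c).
Proof. by move=> oU; exists (cst c) => // k; exact: kdiff_cst. Qed.

Lemma smooth_fctD m (U : set 'rV[R]_m) (f g : U -> R) : open U ->
  smooth_fct f -> smooth_fct g -> smooth_fct (fun u => f u + g u).
Proof.
move=> oU [F sF fF] [G sG gG]; exists (fun x => F x + G x).
  by move=> k; exact: kdiffD.
by move=> u; rewrite fF gG.
Qed.

Lemma smooth_fctM m (U : set 'rV[R]_m) (f g : U -> R) : open U ->
  smooth_fct f -> smooth_fct g -> smooth_fct (fun u => f u * g u).
Proof.
move=> oU [F sF fF] [G sG gG]; exists (fun x => F x * G x).
  by move=> k; exact: kdiffM.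
by move=> u; rewrite fF gG.
Qed.

Lemma smooth_vect_ext m n (U : set 'rV[R]_m) (f : U -> 'rV[R]_n) :
  smooth_vect f -> exists2 F : 'rV[R]_m -> 'rV[R]_n,
    (forall j, smooth_on U (fun x => F x 0 j)) & forall u, f u = F (\val u).
Proof.
move=> sf.
have /choice[F HF] : forall j : 'I_n, exists G : 'rV[R]_m -> R,
    smooth_on U G /\ forall u : U, f u 0 j = G (\val u).
  by move=> j; have [G sG fG] := sf j; exists G.
exists (fun x => \row_j F j x).
  move=> j; have -> : (fun x => (\row_j F j x) 0 j) = F j.
    by apply/funext => x; rewrite mxE.
  exact: (HF j).1.
by move=> u; apply/rowP => j; rewrite mxE (HF j).2.
Qed.

Lemma smooth_fct_comp m n (V : set 'rV[R]_m) (U : set 'rV[R]_n) (p : U -> R)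
    (f : V -> U) : open V -> smooth_fct p -> smooth_vect (fun v => \val (f v)) ->
  smooth_fct (p \o f).
Proof.
move=> oV [P sP pP] /smooth_vect_ext[F sF fF]; exists (P \o F).
  move=> k; apply: (@kdiff_comp _ _ _ V U) => //.
  - move=> x Vx; have := fF (SigSub (mem_set Vx)); rewrite /= => <-.
    exact: set_valP.
  - by move=> j; exact: sF.
by move=> v /=; rewrite pP fF.
Qed.

Lemma smooth_vect_comp m n l (V : set 'rV[R]_m) (U : set 'rV[R]_n)
    (p : U -> 'rV[R]_l) (f : V -> U) : open V -> smooth_vect p ->
  smooth_vect (fun v => \val (f v)) -> smooth_vect (p \o f).
Proof. by move=> oV sp sf j; exact: smooth_fct_comp (sp j) sf. Qed.

Lemma smooth_vect_subincl m (V U : set 'rV[R]_m) (VU : V `<=` U) : open V ->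
  smooth_vect (fun v => \val (subincl VU v)).
Proof.
by move=> oV j; exists (fun x => x 0 j) => // k; exact: kdiff_coord.
Qed.

Lemma kdiff_local m (U : set 'rV[R]_m) k (f : 'rV[R]_m -> R) :
  (forall x, U x -> exists2 V : set 'rV[R]_m, V x & kdiff V k f) -> kdiff U k f.
Proof.
elim: k f => [//|k IH] f loc; split=> [x /loc[V Vx [df _]]|i]; first exact: df.
by apply: IH => x /loc[V Vx [_ Df]]; exists V => //; exact: Df i.
Qed.

Lemma smooth_fct_local m (U : set 'rV[R]_m) (p : U -> R) (I : Type)
    (V : I -> set 'rV[R]_m) (VU : forall i, V i `<=` U) :
  (forall i, open (V i)) -> U `<=` \bigcup_i V i ->
  (forall i, smooth_fct (p \o subincl (VU i))) -> smooth_fct p.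
Proof.
move=> oV UV sp.
pose P x : R := if pselect (U x) is left Ux then p (SigSub (mem_set Ux)) else 0.
have PE (u : U) : p u = P (\val u).
  rewrite /P; case: pselect => [Uu|]; last by have := set_valP u.
  by congr p; exact: val_inj.
exists P => // k; apply: kdiff_local => x /UV[i _ Vix]; exists (V i) => //.
have [F sF pF] := sp i.
apply: kdiff_eq (sF k) => // y Viy.
have := pF (SigSub (mem_set Viy)); rewrite /= => <-.
by rewrite PE.
Qed.

Definition preimS m n (W : set 'rV[R]_m) (U : set 'rV[R]_n) (f : W -> U)
  (V : set 'rV[R]_n) := [set x | exists2 w : W, \val w = x & V (\val (f w))].

Lemma preimS_sub m n (W : set 'rV[R]_m) (U : set 'rV[R]_n) (f : W -> U) V :
  preimS f V `<=` W.
Proof. by move=> _ [w <- _]; exact: set_valP. Qed.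

Lemma preimS_open m n (W : set 'rV[R]_m) (U : set 'rV[R]_n) (f : W -> U) V :
  open W -> smooth_vect (fun w => \val (f w)) -> open V -> open (preimS f V).
Proof.
move=> oW /smooth_vect_ext[F sF fF] oV.
have -> : preimS f V = W `&` F @^-1` V.
  apply/seteqP; split=> [x [w <- Vfw]|x [Wx VFx]].
    by split; [exact: set_valP|rewrite /= -fF].
  by exists (SigSub (mem_set Wx)) => //; rewrite fF.
rewrite openE => x [Wx VFx].
apply: filterI; first by have := open_nbhs_nbhs (conj oW Wx).
have dF : differentiable F x.
  by apply: differentiable_vect => j; have [dFj _] := sF j 1%N; exact: dFj.
apply: (differentiable_continuous dF).
exact: open_nbhs_nbhs (conj oV VFx).
Qed.

Lemma preimS_restr m n (W : set 'rV[R]_m) (U V : set 'rV[R]_n)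
    (VU : V `<=` U) (f : W -> U) :
  open W -> smooth_vect (fun w => \val (f w)) -> open V ->
  exists2 g : preimS f V -> V, smooth_vect (fun w => \val (g w)) &
    forall w, f (subincl (@preimS_sub _ _ _ _ f V) w) = subincl VU (g w).
Proof.
move=> oW sf oV; have oW' := preimS_open oW sf oV.
have Vf (w : preimS f V) : V (\val (f (subincl (@preimS_sub _ _ _ _ f V) w))).
  have [w' w'w Vw'] := set_valP w.
  by rewrite (_ : subincl _ _ = w') //; exact: val_inj.
exists (fun w => SigSub (mem_set (Vf w))); last by move=> w; exact: val_inj.
exact: (smooth_vect_comp oW' sf (smooth_vect_subincl _ oW')).
Qed.

Lemma plot_subincl (X : diffSpace) n (V U : set 'rV[R]_n) (VU : V `<=` U)
    (p : U -> X) : open V -> is_plot p -> is_plot (p \o subincl VU).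
Proof. by move=> oV pp; apply: plot_comp => //; exact: smooth_vect_subincl. Qed.

Program Definition euclidean_space (n : nat) : diffSpace :=
  @DiffSpace 'rV[R]_n (@Diffeology 'rV[R]_n
    (fun m (U : set 'rV[R]_m) (p : U -> 'rV[R]_n) => open U /\ smooth_vect p)
    _ _ _ _).
Next Obligation. by move=> n m U p []. Qed.
Next Obligation. by move=> n m U x oU; split=> // j; exact: smooth_fct_cst. Qed.
Next Obligation.
move=> n m U p I V VU oU oV UV sp; split=> // j.
by apply: (@smooth_fct_local _ _ _ I V VU) => // i; exact: (sp i).2 j.
Qed.
Next Obligation.
move=> n l m V U p f oV [oU sp] sf; split=> //; exact: smooth_vect_comp.
Qed.

Program Definition real_space : diffSpace :=
  @DiffSpace R (@Diffeology R
    (fun m (U : set 'rV[R]_m) (p : U -> R) => open U /\ smooth_fct p) _ _ _ _).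
Next Obligation. by move=> m U p []. Qed.
Next Obligation. by move=> m U x oU; split=> //; exact: smooth_fct_cst. Qed.
Next Obligation.
move=> m U p I V VU oU oV UV sp; split=> //.
by apply: (@smooth_fct_local _ _ _ I V VU) => // i; exact: (sp i).2.
Qed.
Next Obligation.
move=> l m V U p f oV [oU sp] sf; split=> //; exact: smooth_fct_comp.
Qed.

Program Definition subset_space (X : diffSpace) (B : set X) : diffSpace :=
  @DiffSpace B (@Diffeology B
    (fun n (U : set 'rV[R]_n) (p : U -> B) => is_plot (fun u => \val (p u) : X))
    _ _ _ _).
Next Obligation. by move=> X B n U p; exact: plot_open. Qed.
Next Obligation. by move=> X B n U x oU; exact: plot_cst. Qed.
Next Obligation. by move=> X B n U p I V VU; exact: plot_local. Qed.
Next Obligation.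
move=> X B m n V U p f oV pp sf.
exact: (plot_comp (p := fun u => \val (p u)) oV pp sf).
Qed.

Program Definition prod_space (X Y : diffSpace) : diffSpace :=
  @DiffSpace (X * Y)%type (@Diffeology (X * Y)%type
    (fun n (U : set 'rV[R]_n) (p : U -> (X * Y)%type) =>
      is_plot (fun u => (p u).1) /\ is_plot (fun u => (p u).2))
    _ _ _ _).
Next Obligation. by move=> X Y n U p [/plot_open]. Qed.
Next Obligation. by move=> X Y n U x oU; split; exact: plot_cst. Qed.
Next Obligation.
by move=> X Y n U p I V VU oU oV UV pp;
   split; apply: (plot_local (VU := VU)) => // i; have [] := pp i.
Qed.
Next Obligation.
move=> X Y m n V U p f oV [p1 p2] sf; split.
  exact: (plot_comp (p := fun u => (p u).1) oV p1 sf).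
exact: (plot_comp (p := fun u => (p u).2) oV p2 sf).
Qed.

Program Definition coprod_space (I : Type) (X : I -> diffSpace) : diffSpace :=
  @DiffSpace {i : I & X i} (@Diffeology {i : I & X i}
    (fun n (U : set 'rV[R]_n) (p : U -> {i : I & X i}) =>
      open U /\ forall u : U, exists (V : set 'rV[R]_n) (VU : V `<=` U) (i : I)
        (q : V -> X i), [/\ open V, V (\val u), is_plot q &
          forall v : V, p (subincl VU v) = existT _ i (q v)])
    _ _ _ _).
Next Obligation. by move=> I X n U p []. Qed.
Next Obligation.
move=> I X n U [i x] oU; split=> // u.
exists U, (@subset_refl _ U), i, (fun=> x); split=> //; first exact: set_valP.
exact: plot_cst.
Qed.
Next Obligation.
move=> I X n U p J V VU oU oV UV pp; split=> // u.
have [j _ Vju] := UV _ (set_valP u).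
have [_ /(_ (SigSub (mem_set Vju)))[V' [V'V [i [q [oV' V'u pq qE]]]]]] := pp j.
exists V', (subset_trans V'V (VU j)), i, q; split=> // v.
by rewrite -qE /=; congr p; exact: val_inj.
Qed.
Next Obligation.
move=> I X m n W U p f oW [oU pp] sf; split=> // w.
have [V [VU [i [q [oV Vfw pq qE]]]]] := pp (f w).
have [g sg gE] := preimS_restr VU oW sf oV.
have oW' := preimS_open oW sf oV.
exists (preimS f V), (@preimS_sub _ _ _ _ f V), i, (q \o g); split=> //.
- by exists w.
- exact: plot_comp.
- by move=> w' /=; rewrite gE qE.
Qed.

Program Definition quot_space (X : diffSpace) (E : equiv_rel {classic X}) :
    diffSpace :=
  @DiffSpace {eq_quot E} (@Diffeology {eq_quot E}
    (fun n (U : set 'rV[R]_n) (p : U -> {eq_quot E}) =>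
      open U /\ forall u : U, exists (V : set 'rV[R]_n) (VU : V `<=` U)
        (q : V -> X), [/\ open V, V (\val u), is_plot q &
          forall v : V, p (subincl VU v) = (\pi_{eq_quot E} (q v))%qT])
    _ _ _ _).
Next Obligation. by move=> X E n U p []. Qed.
Next Obligation.
move=> X E n U x oU; split=> // u.
exists U, (@subset_refl _ U), (fun=> repr x); split=> //; first exact: set_valP.
  exact: plot_cst.
by move=> v; rewrite reprK.
Qed.
Next Obligation.
move=> X E n U p J V VU oU oV UV pp; split=> // u.
have [j _ Vju] := UV _ (set_valP u).
have [_ /(_ (SigSub (mem_set Vju)))[V' [V'V [q [oV' V'u pq qE]]]]] := pp j.
exists V', (subset_trans V'V (VU j)), q; split=> // v.
by rewrite -qE /=; congr p; exact: val_inj.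
Qed.
Next Obligation.
move=> X E m n W U p f oW [oU pp] sf; split=> // w.
have [V [VU [q [oV Vfw pq qE]]]] := pp (f w).
have [g sg gE] := preimS_restr VU oW sf oV.
have oW' := preimS_open oW sf oV.
exists (preimS f V), (@preimS_sub _ _ _ _ f V), (q \o g); split=> //.
- by exists w.
- exact: plot_comp.
- by move=> w' /=; rewrite gE qE.
Qed.

Definition smooth_map (X Y : diffSpace) : Type := {f : X -> Y | smooth f}.

Program Definition fun_space (X Y : diffSpace) : diffSpace :=
  @DiffSpace (smooth_map X Y) (@Diffeology (smooth_map X Y)
    (fun n (U : set 'rV[R]_n) (p : U -> smooth_map X Y) => open U /\
      @smooth (prod_space (@subset_space (euclidean_space n) U) X) Y
        (fun ux => sval (p ux.1) ux.2))
    _ _ _ _).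
Next Obligation. by move=> X Y n U p []. Qed.
Next Obligation.
move=> X Y n U f oU; split=> // m W q [_ q2].
exact: (svalP f _ _ (fun w => (q w).2) q2).
Qed.
Next Obligation.
move=> X Y n U p I V VU oU oV UV pp; split=> // m W q [q1 q2].
have [oW sq1] := q1.
pose q1' (w : W) : U := (q w).1.
have sq1' : smooth_vect (fun w => \val (q1' w)) by exact: sq1.
apply: (plot_local (I := I) (V := fun i => preimS q1' (V i))
  (VU := fun i => @preimS_sub _ _ _ _ q1' (V i))) => //.
- by move=> i; exact: preimS_open.
- move=> x Wx; have [i _ Vi] := UV _ (set_valP (q1' (SigSub (mem_set Wx)))).
  by exists i => //; exists (SigSub (mem_set Wx)).
- move=> i; have [g sg gE] := preimS_restr (VU i) oW sq1' (oV i).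
  have oW' := preimS_open oW sq1' (oV i).
  have [_ /(_ _ _ (fun w => (g w,
    (q (subincl (@preimS_sub _ _ _ _ q1' (V i)) w)).2)))] := pp i.
  have pl : is_plot (fun w => (g w,
      (q (subincl (@preimS_sub _ _ _ _ q1' (V i)) w)).2)
      : prod_space (@subset_space (euclidean_space n) (V i)) X).
    split; first by split.
    exact: (plot_subincl _ oW' q2).
  move=> /(_ pl).
  set a := (X in is_plot X -> _); set b := (X in _ -> plot _ X).
  suff -> : a = b by [].
  by apply/funext => w; rewrite /a /b /= -gE.
Qed.
Next Obligation.
move=> X Y m n V U p f oV [oU pp] sf; split=> // l W q [q1 q2].
have [oW sq1] := q1.
apply: (pp _ _ (fun w => (f (q w).1, (q w).2))); split=> //.
split=> //.
exact: (@smooth_vect_comp _ _ _ _ _ (fun v => \val (f v)) (fun w => (q w).1)).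
Qed.

Lemma D_openT (X : diffSpace) : D_open [set: X].
Proof.
move=> n U p pp; rewrite (_ : [set x | _] = U); first exact: plot_open pp.
apply/seteqP; split=> [_ [u <- _]|x Ux]; first exact: set_valP.
by exists (SigSub (mem_set Ux)).
Qed.

Lemma D_openI (X : diffSpace) (A B : set X) :
  D_open A -> D_open B -> D_open (A `&` B).
Proof.
move=> oA oB n U p pp.
rewrite (_ : [set x | _] = [set x | exists2 u : U, \val u = x & A (p u)] `&`
    [set x | exists2 u : U, \val u = x & B (p u)]).
  by apply: openI; [exact: oA|exact: oB].
apply/seteqP; split=> [_ [u <- [Au Bu]]|_ [[u <- Au] [u' /val_inj u'u Bu]]].
  by split; exists u.
by exists u => //; split=> //; rewrite -u'u.
Qed.

End Diffeologies.

Section Germs.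
Variables (R : realType) (X : diffSpace R) (x : X).

Definition D_nbhd : Type := {B : set X | D_open B /\ B x}.

Definition local_space : diffSpace R :=
  coprod_space (fun B : D_nbhd =>
    fun_space (@subset_space R X (sval B)) (real_space R)).

Definition local_dom (a : local_space) : set X := sval (projT1 a).

Definition local_fun (a : local_space) : local_dom a -> R := sval (projT2 a).

(* Equality in the colimit, which is filtered. *)
Definition germ_rel (a b : local_space) : Prop :=
  exists (W : set X) (WA : W `<=` local_dom a) (WB : W `<=` local_dom b),
    [/\ D_open W, W x &
      forall w : W, local_fun (subincl WA w) = local_fun (subincl WB w)].

Lemma local_dom_open a : D_open (local_dom a).
Proof. exact: (svalP (projT1 a)).1. Qed.

Lemma local_dom_pt a : local_dom a x.
Proof. exact: (svalP (projT1 a)).2. Qed.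

Definition local_ext (a : local_space) (y : X) : R :=
  if pselect (local_dom a y) is left ay
  then local_fun (SigSub (mem_set ay) : local_dom a) else 0.

Lemma local_extE a (y : local_dom a) : local_fun y = local_ext a (\val y).
Proof.
rewrite /local_ext; case: pselect => [ay|]; last by have := set_valP y.
by congr local_fun; exact: val_inj.
Qed.

Definition D_near (P : set X) := exists W : set X, [/\ D_open W, W x & W `<=` P].

Lemma D_nearI P Q : D_near P -> D_near Q -> D_near (P `&` Q).
Proof.
move=> [W [oW Wx WP]] [W' [oW' W'x WQ]]; exists (W `&` W'); split=> //.
  exact: D_openI.
by move=> y [/WP ? /WQ].
Qed.

Lemma D_nearS P Q : P `<=` Q -> D_near P -> D_near Q.
Proof.
by move=> PQ [W [oW Wx WP]]; exists W; split=> //; exact: subset_trans PQ.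
Qed.

Lemma D_nearT P : (forall y, P y) -> D_near P.
Proof. by move=> HP; exists setT; split=> //; exact: D_openT. Qed.

Lemma D_near_dom a : D_near (local_dom a).
Proof.
by exists (local_dom a); split=> //; [exact: local_dom_open|exact: local_dom_pt].
Qed.

Lemma germ_relP a b :
  germ_rel a b <-> D_near (fun y => local_ext a y = local_ext b y).
Proof.
split=> [[W [WA [WB [oW Wx E]]]]|H].
  exists W; split=> // y Wy; have := E (SigSub (mem_set Wy)).
  by rewrite !local_extE.
have [W [oW Wx WP]] := D_nearI H (D_nearI (D_near_dom a) (D_near_dom b)).
have WA : W `<=` local_dom a by move=> y /WP[_ []].
have WB : W `<=` local_dom b by move=> y /WP[_ []].
by exists W, WA, WB; split=> // w; rewrite !local_extE;
  have [] := WP _ (set_valP w).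
Qed.

Definition germ_relb (a b : {classic local_space}) : bool := `[< germ_rel a b >].

Lemma germ_relb_refl : reflexive germ_relb.
Proof. by move=> a; apply/asboolP/germ_relP; exact: D_nearT. Qed.

Lemma germ_relb_sym : symmetric germ_relb.
Proof.
by move=> a b; apply/asbool_equiv_eq; split=> /germ_relP H; apply/germ_relP;
  apply: D_nearS H => y.
Qed.

Lemma germ_relb_trans : transitive germ_relb.
Proof.
move=> b a c /asboolP/germ_relP ab /asboolP/germ_relP bc.
by apply/asboolP/germ_relP; apply: D_nearS (D_nearI ab bc) => y [-> ->].
Qed.

Canonical germ_equiv : equiv_rel {classic local_space} :=
  EquivRel germ_relb germ_relb_refl germ_relb_sym germ_relb_trans.

Definition germ_space : diffSpace R := quot_space germ_equiv.

Definition germ : Type := {eq_quot germ_equiv}.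
HB.instance Definition _ := Choice.on germ.
HB.instance Definition _ := EqQuotient.on germ.

Definition germ_of (a : local_space) : germ := \pi_germ (a : {classic local_space}).

Lemma germ_ofP a b :
  germ_of a = germ_of b <-> D_near (fun y => local_ext a y = local_ext b y).
Proof.
rewrite -germ_relP; split=> [/eqmodP/asboolP //|H].
by apply/eqmodP/asboolP.
Qed.

Lemma germ_ind (P : germ -> Prop) : (forall a, P (germ_of a)) -> forall g, P g.
Proof. by move=> Pa; elim/quotW. Qed.

Definition germ_val (g : germ) : R :=
  let a : local_space := repr g in
  local_fun (SigSub (mem_set (local_dom_pt a)) : local_dom a).

Lemma germ_val_local_ext a : germ_val (germ_of a) = local_ext a x.
Proof.
rewrite /germ_val local_extE /=.
have /germ_ofP[W [_ Wx WP]] : germ_of (repr (germ_of a)) = germ_of a.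
  exact: reprK.
exact: WP.
Qed.

Lemma germ_val_of (a : local_space) :
  germ_val (germ_of a) =
  local_fun (SigSub (mem_set (local_dom_pt a)) : local_dom a).
Proof. by rewrite germ_val_local_ext local_extE. Qed.

Lemma D_nbhdT_subproof : D_open [set: X] /\ [set: X] x.
Proof. by split=> //; exact: D_openT. Qed.

Lemma D_nbhdI_subproof (A B : D_nbhd) :
  D_open (sval A `&` sval B) /\ (sval A `&` sval B) x.
Proof.
case: A B => [A [oA Ax]] [B [oB Bx]] /=.
by split; [exact: D_openI|split].
Qed.

Definition D_nbhdT : D_nbhd := exist _ _ D_nbhdT_subproof.
Definition D_nbhdI (A B : D_nbhd) : D_nbhd := exist _ _ (D_nbhdI_subproof A B).

Lemma local_cst_subproof (c : R) :
  @smooth R (@subset_space R X (sval D_nbhdT)) (real_space R) (fun=> c).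
Proof.
by move=> n U p /plot_open oU; split=> //; exact: smooth_fct_cst.
Qed.

Definition local_cst (c : R) : local_space :=
  existT _ D_nbhdT (exist _ _ (@local_cst_subproof c)).

Section Op2.
Variable op : R -> R -> R.
Hypothesis sop : forall n (U : set 'rV[R]_n) (f g : U -> R), open U ->
  smooth_fct f -> smooth_fct g -> smooth_fct (fun u => op (f u) (g u)).

Lemma local_op_subproof (a b : local_space) :
  @smooth R (@subset_space R X (sval (D_nbhdI (projT1 a) (projT1 b))))
    (real_space R)
    (fun y => op (local_fun (subincl (@subIsetl _ _ _) y : local_dom a))
                 (local_fun (subincl (@subIsetr _ _ _) y : local_dom b))).
Proof.
move=> n U p pp; have oU := plot_open pp.
split=> //; apply: sop => //.
  have pl : is_plot (fun u => subincl (@subIsetl _ _ _) (p u)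
    : @subset_space R X (local_dom a)) by [].
  exact: (svalP (projT2 a) _ _ _ pl).2.
have pl : is_plot (fun u => subincl (@subIsetr _ _ _) (p u)
  : @subset_space R X (local_dom b)) by [].
exact: (svalP (projT2 b) _ _ _ pl).2.
Qed.

Definition local_op (a b : local_space) : local_space :=
  existT _ (D_nbhdI (projT1 a) (projT1 b)) (exist _ _ (@local_op_subproof a b)).

Definition germ_op (g h : germ) : germ := germ_of (local_op (repr g) (repr h)).

End Op2.

Lemma local_op_ext op sop a b :
  D_near (fun y => local_ext (@local_op op sop a b) y =
    op (local_ext a y) (local_ext b y)).
Proof.
exists (local_dom a `&` local_dom b); split.
- by apply: D_openI; exact: local_dom_open.
- by split; exact: local_dom_pt.
- move=> y ab.
  have := local_extE (SigSub (mem_set ab) : local_dom (local_op sop a b)).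
  by move=> /= <-; rewrite /local_op {1}/local_fun /= !local_extE.
Qed.

Lemma germ_op_of op sop a b :
  @germ_op op sop (germ_of a) (germ_of b) = germ_of (local_op sop a b).
Proof.
have rK c : germ_of (repr (germ_of c)) = germ_of c by exact: reprK.
have /germ_ofP Ha := rK a; have /germ_ofP Hb := rK b.
have Hab := D_nearI (local_op_ext sop a b) (D_nearI Ha Hb).
apply/germ_ofP.
apply: D_nearS (D_nearI
  (local_op_ext sop (repr (germ_of a)) (repr (germ_of b))) Hab).
by move=> y [-> [-> [-> ->]]].
Qed.

Definition germ_cst (c : R) : germ := germ_of (local_cst c).
Definition germ_add : germ -> germ -> germ := germ_op (@smooth_fctD R).
Definition germ_mul : germ -> germ -> germ := germ_op (@smooth_fctM R).
Definition germ_opp (g : germ) : germ := germ_mul (germ_cst (-1)) g.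
Definition germ_scale (c : R) (g : germ) : germ := germ_mul (germ_cst c) g.

Lemma local_cst_ext c : forall y, local_ext (local_cst c) y = c.
Proof.
move=> y.
have := local_extE (SigSub (@mem_set _ [set: X] y I) : local_dom (local_cst c)).
by move=> /= <-.
Qed.

(* [germ_like g phi]: near x, g is the germ of phi. *)
Definition germ_like (g : germ) (phi : X -> R) :=
  exists2 a, g = germ_of a & D_near (fun y => local_ext a y = phi y).

Lemma germ_likeP g h phi : germ_like g phi -> germ_like h phi -> g = h.
Proof.
move=> [a -> aP] [b -> bP]; apply/germ_ofP.
by apply: D_nearS (D_nearI aP bP) => y [-> ->].
Qed.

Lemma like_op op sop g h phi psi : germ_like g phi -> germ_like h psi ->
  germ_like (@germ_op op sop g h) (fun y => op (phi y) (psi y)).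
Proof.
move=> [a -> aP] [b -> bP]; exists (local_op sop a b); first exact: germ_op_of.
apply: D_nearS (D_nearI (local_op_ext sop a b) (D_nearI aP bP)).
by move=> y [-> [-> ->]].
Qed.

Lemma like_cst c : germ_like (germ_cst c) (fun=> c).
Proof. by exists (local_cst c) => //; apply: D_nearT => y; exact: local_cst_ext. Qed.

Lemma like_ex g : exists phi, germ_like g phi.
Proof.
by elim/germ_ind: g => a; exists (local_ext a); exists a => //; exact: D_nearT.
Qed.

Lemma like_eq g h phi psi : germ_like g phi -> germ_like h psi ->
  (forall y, phi y = psi y) -> g = h.
Proof. by move=> gp hp /funext E; rewrite E in gp; exact: germ_likeP gp hp. Qed.

Lemma like_add g h phi psi : germ_like g phi -> germ_like h psi ->
  germ_like (germ_add g h) (fun y => phi y + psi y).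
Proof. exact: like_op. Qed.

Lemma like_mul g h phi psi : germ_like g phi -> germ_like h psi ->
  germ_like (germ_mul g h) (fun y => phi y * psi y).
Proof. exact: like_op. Qed.

Fact germ_addA : associative germ_add.
Proof.
move=> f g h; have [p fp] := like_ex f; have [q gq] := like_ex g.
have [r hr] := like_ex h.
apply: like_eq (like_add fp (like_add gq hr)) (like_add (like_add fp gq) hr) _.
by move=> y; rewrite addrA.
Qed.

Fact germ_addC : commutative germ_add.
Proof.
move=> f g; have [p fp] := like_ex f; have [q gq] := like_ex g.
by apply: like_eq (like_add fp gq) (like_add gq fp) _ => y; rewrite addrC.
Qed.

Fact germ_add0 : left_id (germ_cst 0) germ_add.
Proof.
move=> f; have [p fp] := like_ex f.
by apply: like_eq (like_add (like_cst 0) fp) fp _ => y; rewrite add0r.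
Qed.

Fact germ_addN : left_inverse (germ_cst 0) germ_opp germ_add.
Proof.
move=> f; have [p fp] := like_ex f.
apply: like_eq (like_add (like_mul (like_cst (-1)) fp) fp) (like_cst 0) _ => y.
by rewrite mulN1r addNr.
Qed.

HB.instance Definition _ := GRing.isZmodule.Build germ
  germ_addA germ_addC germ_add0 germ_addN.

Fact germ_mulA : associative germ_mul.
Proof.
move=> f g h; have [p fp] := like_ex f; have [q gq] := like_ex g.
have [r hr] := like_ex h.
apply: like_eq (like_mul fp (like_mul gq hr)) (like_mul (like_mul fp gq) hr) _.
by move=> y; rewrite mulrA.
Qed.

Fact germ_mulC : commutative germ_mul.
Proof.
move=> f g; have [p fp] := like_ex f; have [q gq] := like_ex g.
by apply: like_eq (like_mul fp gq) (like_mul gq fp) _ => y; rewrite mulrC.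
Qed.

Fact germ_mul1 : left_id (germ_cst 1) germ_mul.
Proof.
move=> f; have [p fp] := like_ex f.
by apply: like_eq (like_mul (like_cst 1) fp) fp _ => y; rewrite mul1r.
Qed.

Fact germ_mulDl : left_distributive germ_mul germ_add.
Proof.
move=> f g h; have [p fp] := like_ex f; have [q gq] := like_ex g.
have [r hr] := like_ex h.
apply: like_eq (like_mul (like_add fp gq) hr)
  (like_add (like_mul fp hr) (like_mul gq hr)) _ => y.
by rewrite mulrDl.
Qed.

Fact germ_one_neq0 : germ_cst 1 != 0 :> germ.
Proof.
apply/eqP => /(congr1 germ_val); rewrite /germ_cst.
rewrite !germ_val_local_ext !local_cst_ext.
by move/eqP; rewrite oner_eq0.
Qed.

HB.instance Definition _ := GRing.Zmodule_isComNzRing.Build germ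
  germ_mulA germ_mulC germ_mul1 germ_mulDl germ_one_neq0.

Fact germ_scaleA c d (g : germ) :
  germ_scale c (germ_scale d g) = germ_scale (c * d) g.
Proof.
have [p gp] := like_ex g.
apply: like_eq (like_mul (like_cst c) (like_mul (like_cst d) gp))
  (like_mul (like_cst (c * d)) gp) _ => y.
by rewrite mulrA.
Qed.

Fact germ_scale1 : left_id 1 germ_scale.
Proof. exact: germ_mul1. Qed.

Fact germ_scaleDr : right_distributive germ_scale +%R.
Proof. by move=> c f g; rewrite /germ_scale; exact: mulrDr. Qed.

Fact germ_scaleDl (g : germ) : {morph germ_scale^~ g : c d / c + d}.
Proof.
move=> c d; have [p gp] := like_ex g.
apply: like_eq (like_mul (like_cst (c + d)) gp)
  (like_add (like_mul (like_cst c) gp) (like_mul (like_cst d) gp)) _ => y.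
by rewrite mulrDl.
Qed.

HB.instance Definition _ := GRing.Zmodule_isLmodule.Build R germ
  germ_scaleA germ_scale1 germ_scaleDr germ_scaleDl.

Fact germ_scaleAl c (f g : germ) : c *: (f * g) = (c *: f) * g.
Proof. exact: mulrA. Qed.

HB.instance Definition _ := GRing.Lmodule_isLalgebra.Build R germ germ_scaleAl.
HB.instance Definition _ := GRing.Lalgebra_isComAlgebra.Build R germ.

End Germs.

Section LinearMaps.
Variables (K : comNzRingType) (U V : lmodType K).

Definition linear_pred : {pred (U -> V)} := fun f => `[< linear f >].

Fact linear_pred_submod_closed : submod_closed linear_pred.
Proof.
split=> [|c f g /asboolP lf /asboolP lg]; apply/asboolP => a u v.
  by rewrite -[RHS]/(a *: 0 + 0) scaler0 addr0.
have cfgE w : (c *: f + g) w = c *: f w + g w by [].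
rewrite !cfgE lf lg !scalerDr !scalerA [c * a]mulrC.
by rewrite -!addrA; congr (_ + _); rewrite addrCA.
Qed.

HB.instance Definition _ :=
  GRing.isSubmodClosed.Build K (U -> V) linear_pred linear_pred_submod_closed.

(* Hom_K(U, V) as a K-module; [{linear U -> V}] has no module structure. *)
Record linear_map := LinearMap {
  linear_map_fun :> U -> V;
  linear_mapP : linear_map_fun \in linear_pred
}.

HB.instance Definition _ := [isSub for linear_map_fun].
HB.instance Definition _ := [Choice of linear_map by <:].
HB.instance Definition _ := [SubChoice_isSubLmodule of linear_map by <:].

HB.instance Definition _ (f : linear_map) :=
  GRing.isLinear.Build K U V *:%R (linear_map_fun f) (asboolW (linear_mapP f)).

End LinearMaps.

Section TangentSpaces.
Variables (R : realType) (X : diffSpace R) (x : X).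

Definition leibniz_pred : {pred linear_map (germ x) R^o} := fun D =>
  `[< forall g h : germ x,
        D (g * h) = germ_val g * D h + germ_val h * D g >].

Fact leibniz_pred_submod_closed : submod_closed leibniz_pred.
Proof.
split=> [|c D E /asboolP lD /asboolP lE]; apply/asboolP => g h.
  by rewrite !mulr0 addr0.
have LE (y : germ x) : (c *: D + E) y = c * D y + E y by [].
rewrite !LE lD lE !mulrDr !mulrA [c * germ_val g]mulrC [c * germ_val h]mulrC.
by rewrite -!addrA; congr (_ + _); rewrite addrCA.
Qed.

HB.instance Definition _ := GRing.isSubmodClosed.Build R
  (linear_map (germ x) R^o) leibniz_pred leibniz_pred_submod_closed.

Record right_tangent := RightTangent {
  right_tangent_map :> linear_map (germ x) R^o;
  right_tangentP : right_tangent_map \in leibniz_pred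
}.

HB.instance Definition _ := [isSub for right_tangent_map].
HB.instance Definition _ := [Choice of right_tangent by <:].
HB.instance Definition _ := [SubChoice_isSubLmodule of right_tangent by <:].

Definition smooth_derivation : {pred right_tangent} := fun D =>
  `[< @smooth R (germ_space x) (real_space R) D >].

Fact smooth_derivation_submod_closed : submod_closed smooth_derivation.
Proof.
split=> [|c D E /asboolP sD /asboolP sE]; apply/asboolP => n U p pp.
  by split; [exact: plot_open pp|exact: smooth_fct_cst (plot_open pp)].
have [oU sDp] := sD _ _ _ pp; have [_ sEp] := sE _ _ _ pp.
split=> //.
exact: (smooth_fctD oU (smooth_fctM oU (smooth_fct_cst c oU) sDp) sEp).
Qed.

HB.instance Definition _ := GRing.isSubmodClosed.Build R
  right_tangent smooth_derivation smooth_derivation_submod_closed.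

Record external_tangent := ExternalTangent {
  external_tangent_val :> right_tangent;
  external_tangentP : external_tangent_val \in smooth_derivation
}.

HB.instance Definition _ := [isSub for external_tangent_val].
HB.instance Definition _ := [Choice of external_tangent by <:].
HB.instance Definition _ := [SubChoice_isSubLmodule of external_tangent by <:].

End TangentSpaces.

Section DirectSum.
Variables (K : nzRingType) (I : choiceType).

Definition finsupp_pred : {pred (I -> K^o)} := fun f =>
  `[< finite_set [set i | f i != 0] >].

Fact finsupp_pred_submod_closed : submod_closed finsupp_pred.
Proof.
split=> [|c f g /asboolP ff /asboolP fg]; apply/asboolP.
  rewrite (_ : [set _ | _] = set0) //.
  by apply/seteqP; split=> // i /=; rewrite eqxx.
have fU : finite_set ([set i | f i != 0] `|` [set i | g i != 0]).
  by rewrite finite_setU.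
apply: sub_finite_set fU => i /=.
have [f0|] := eqVneq (f i) 0; last by left.
rewrite !fctE f0 scaler0 add0r; by right.
Qed.

HB.instance Definition _ := GRing.isSubmodClosed.Build K (I -> K^o)
  finsupp_pred finsupp_pred_submod_closed.

Record direct_sum := DirectSum {
  direct_sum_fun :> I -> K^o;
  direct_sumP : direct_sum_fun \in finsupp_pred
}.

HB.instance Definition _ := [isSub for direct_sum_fun].
HB.instance Definition _ := [Choice of direct_sum by <:].
HB.instance Definition _ := [SubChoice_isSubLmodule of direct_sum by <:].

End DirectSum.

Section Dimension.
Variables (K : fieldType) (V : lmodType K).

Definition hamel_basis (B : set V) : Prop :=
  (forall (s : seq V) (c : V -> K), uniq s -> [set` s] `<=` B ->
     \sum_(v <- s) c v *: v = 0 -> forall v, v \in s -> c v = 0) /\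
  (forall v : V, exists (s : seq V) (c : V -> K),
     [set` s] `<=` B /\ v = \sum_(u <- s) c u *: u).

Definition dim_eq (T : Type) (A : set T) : Prop :=
  exists2 B : set V, hamel_basis B & B #= A.

(* The cardinality of [A] is smaller than the dimension of [V]. *)
Definition dim_gt (T : Type) (A : set T) : Prop :=
  exists2 B : set V, hamel_basis B & (A #<= B) && ~~ (B #<= A).

End Dimension.

Section Bouquet.
Variable R : realType.

(* The copies of R are indexed by [nat] rather than by the positive integers. *)
Definition wedge_rel (a b : coprod_space (fun _ : nat => real_space R)) : Prop :=
  a = b \/ (projT2 a = 0 :> R /\ projT2 b = 0 :> R).

Definition wedge_relb
  (a b : {classic coprod_space (fun _ : nat => real_space R)}) : bool :=
  `[< wedge_rel a b >].

Lemma wedge_relb_refl : reflexive wedge_relb.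
Proof. by move=> a; apply/asboolP; left. Qed.

Lemma wedge_relb_sym : symmetric wedge_relb.
Proof.
by move=> a b; apply/asbool_equiv_eq; split=> -[->|[? ?]]; [left|right|left|right].
Qed.

Lemma wedge_relb_trans : transitive wedge_relb.
Proof.
move=> b a c /asboolP[->//|[a0 b0]] /asboolP[<-|[_ c0]]; apply/asboolP; right;
  by split.
Qed.

Canonical wedge_equiv := EquivRel wedge_relb
  wedge_relb_refl wedge_relb_sym wedge_relb_trans.

Definition bouquet : diffSpace R := quot_space wedge_equiv.

Definition wedge_point : bouquet :=
  \pi_{eq_quot wedge_equiv}
    (existT (fun _ => R) 0%N 0
     : {classic coprod_space (fun _ : nat => real_space R)}).

End Bouquet.

(* Main.v *)
(* A germ at the wedge point is a sequence of germs of one-variable functions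
   with a common value, the neighbourhoods of the different branches being
   independent.  By Hadamard's lemma on each branch, a germ with value and all
   slopes zero is a product of two germs vanishing at the wedge point, so every
   derivation factors through the sequence of slopes, and right tangent vectors
   are the linear functionals on [nat -> R].  If such a functional is smooth it
   is continuous along the curves of sequences whose components are polynomials,
   and Newton interpolation through an unbounded sequence of values shows that
   it vanishes on all sequences with a long enough initial segment of zeros.
   The dual of [nat -> R] is not spanned by countably many functionals, by
   diagonalization with a linear extension of the limit functional. *)

Require Import Defs.
From HB Require Import structures.
From mathcomp Require Import all_boot all_order all_algebra.
From mathcomp Require Import generic_quotient.
From mathcomp Require Import all_classical all_reals all_analysis.
From mathcomp Require Import ring lra zify.

Set Implicit Arguments.
Unset Strict Implicit.
Unset Printing Implicit Defensive.

Import Order.TTheory GRing.Theory Num.Theory.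
Import numFieldNormedType.Exports.

Local Open Scope classical_set_scope.
Local Open Scope ring_scope.

(** * Smooth functions of one variable and Hadamard's lemma *)

Section OneVariable.
Variable R : realType.
Implicit Types (f g P G : R -> R) (e x y : R) (k : nat).

Definition symint e : set 'rV[R]_1 := [set u | `|u 0 0| < e].

Lemma symint_open e : open (symint e).
Proof.
have -> : symint e = (fun u : 'rV[R]_1 => u 0 0) @^-1` (ball 0 e).
  by apply/seteqP; split=> u; rewrite /symint /ball /= sub0r normrN.
have cc : continuous (fun u : 'rV[R]_1 => u 0 0) by exact: coord_continuous.
by move/continuousP: cc; apply; exact: ball_open.
Qed.

(** The difference quotients agree as functions, so derivatives and derivability both pass between
    ['rV[R]_1] and [R] by rewriting. *)
Lemma coord_slope f (u : 'rV[R]_1) :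
  (fun h : R => h^-1 *: (((fun v : 'rV[R]_1 => f (v 0 0)) \o shift u)
     (h *: delta_mx 0 0) - f (u 0 0))) =
  (fun h : R => h^-1 *: ((f \o shift (u 0 0)) (h *: 1) - f (u 0 0))).
Proof. by apply/funext => h /=; rewrite !mxE /= mulr1n. Qed.

Lemma derive_coord f (u : 'rV[R]_1) :
  'D_(delta_mx 0 0) (fun v : 'rV[R]_1 => f (v 0 0)) u = derive1 f (u 0 0).
Proof. by rewrite derive1E /derive coord_slope. Qed.

Lemma differentiable_coordP f (u : 'rV[R]_1) :
  differentiable (fun v : 'rV[R]_1 => f (v 0 0)) u <-> derivable f (u 0 0) 1.
Proof.
split=> [/diff_derivable df|/derivable1_diffP df].
  by have := df (delta_mx 0 0); rewrite /derivable coord_slope.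
by apply: (@differentiable_comp _ _ _ _ (fun v : 'rV[R]_1 => v 0 0) f) => //;
  exact: differentiable_coord.
Qed.

Lemma kdiff_coordS (U : set 'rV[R]_1) k f :
  kdiff U k.+1 (fun u => f (u 0 0)) <->
  (forall u, U u -> derivable f (u 0 0) 1) /\
  kdiff U k (fun u => derive1 f (u 0 0)).
Proof.
have E : (fun u : 'rV[R]_1 => 'D_(delta_mx 0 0) (fun v : 'rV[R]_1 => f (v 0 0)) u) =
    fun u => derive1 f (u 0 0).
  by apply/funext => u; exact: derive_coord.
split=> [[df Df]|[df Df]]; split.
- by move=> u /df/differentiable_coordP.
- by have := Df 0; rewrite E.
- by move=> u /df/differentiable_coordP.
- by move=> i; rewrite ord1 E.
Qed.

Lemma mean_value0 e f f' x : (forall y, `|y| < e -> is_derive y 1 f (f' y)) ->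
  `|x| < e -> exists2 y, `|y| <= `|x| & f x - f 0 = f' y * x.
Proof.
move=> df xe.
have cf a b : (forall y, a <= y <= b -> `|y| < e) ->
    {within `[a, b], continuous f}.
  move=> ab; apply: continuous_in_subspaceT => y /set_mem/=.
  rewrite in_itv /= => /ab ye; apply: differentiable_continuous.
  by apply/derivable1_diffP; have [] := df _ ye.
case: (ltgtP x 0) => [x0|x0|->]; last first.
- by exists 0; rewrite // subrr mulr0.
- have [||y] := @MVT R f f' 0 x x0.
  + move=> y; rewrite in_itv /= => /andP[y0 yx]; apply: df.
    by rewrite gtr0_norm // (lt_trans yx) // -(gtr0_norm x0).
  + apply: cf => y /andP[y0 yx]; rewrite ger0_norm // (le_lt_trans yx) //.
    by rewrite -(gtr0_norm x0).
  rewrite in_itv /= => /andP[y0 yx] E; exists y; last by rewrite E subr0.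
  by rewrite !gtr0_norm // ltW.
- have [||y] := @MVT R f f' x 0 x0.
  + move=> y; rewrite in_itv /= => /andP[xy y0]; apply: df.
    by rewrite ltr0_norm // (le_lt_trans _ xe) // ltr0_norm // lerN2 ltW.
  + apply: cf => y /andP[xy y0]; rewrite ler0_norm // (le_lt_trans _ xe) //.
    by rewrite ltr0_norm // lerN2.
  rewrite in_itv /= => /andP[xy y0] E; exists y.
    by rewrite !ltr0_norm // lerN2 ltW.
  by rewrite -opprB E sub0r mulrN opprK.
Qed.

(* For [P] with [P 0 = 0] and [P' x = x ^ k * G x], this is
   [\int_0^1 t^k G(t x) dt]; no integral is needed since such primitives are
   available explicitly for the iterated derivatives. *)
Definition hadamard_quot k P G x :=
  if x == 0 then G 0 / k.+1%:R else P x / x ^+ k.+1.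

(** Let [E] be [P] minus the primitive of [x ^ k] times the first Taylor polynomial of [G] at 0.
    Then [E' = o(x ^ k.+1)], so [E = o(x ^ k.+2)] by the mean value theorem, and [E h / h ^ k.+2] is
    the difference quotient minus its claimed limit. *)
Lemma is_derive_hadamard_quot0 e k P G : 0 < e -> P 0 = 0 ->
  (forall x, `|x| < e -> is_derive x 1 P (x ^+ k * G x)) ->
  derivable G 0 1 ->
  is_derive (0 : R) 1 (hadamard_quot k P G) (derive1 G 0 / k.+2%:R).
Proof.
move=> e0 P0 dP dG.
suff H : h^-1 *: (hadamard_quot k P G (h *: 1 + 0) - hadamard_quot k P G 0)
    @[h --> 0^'] --> derive1 G 0 / k.+2%:R.
  by apply: DeriveDef; [apply/cvg_ex; eexists; exact: H|exact: cvg_lim].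
have dG' : h^-1 *: (G (h *: 1 + 0) - G 0) @[h --> 0^'] --> derive1 G 0.
  by rewrite derive1E; exact: dG.
pose E x := P x - (G 0 / k.+1%:R * x ^+ k.+1 + derive1 G 0 / k.+2%:R * x ^+ k.+2).
have dE x : `|x| < e -> is_derive x 1 E (x ^+ k * (G x - G 0 - derive1 G 0 * x)).
  move=> /dP dPx.
  have -> : E = P - ((G 0 / k.+1%:R) *: ((@id R) ^+ k.+1) +
      (derive1 G 0 / k.+2%:R) *: ((@id R) ^+ k.+2)).
    by apply/funext => y; rewrite /E /= !fctE.
  apply: is_derive_eq.
  rewrite /GRing.scale /= exprS.
  have : k.+1%:R != 0 :> R by rewrite pnatr_eq0.
  have : k.+2%:R != 0 :> R by rewrite pnatr_eq0.
  move: (k.+1%:R : R) (k.+2%:R : R) => a b b0 a0; field.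
  by apply/andP.
apply/cvgrPdist_le => d d0.
have /cvgrPdist_le/(_ _ d0)[/= r r0 rG] := dG'.
have G1 y : `|y| < r -> `|G y - G 0 - derive1 G 0 * y| <= d * `|y|.
  have [->|y0] := eqVneq y 0; first by rewrite mulr0 subrr subr0 normr0 mulr0.
  move=> yr; have := rG y; rewrite /ball /= sub0r normrN => /(_ yr y0).
  rewrite /GRing.scale /= mulr1 addr0 => H.
  rewrite -(@ler_pM2r _ `|y|^-1) ?invr_gt0 ?normr_gt0 //.
  rewrite mulfK ?normr_eq0 // -normfV -normrM -normrN.
  by move: H; congr (`|_| <= _); field.
exists (Num.min r e); first by rewrite /= lt_min r0.
move=> h /=; rewrite /ball /= sub0r normrN lt_min => /andP[hr he] h0.
have [y yh] := mean_value0 dE he.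
rewrite /E P0 !expr0n /= !mulr0 addr0 !subr0.
set D := _ - (_ + _) => ED.
have -> : derive1 G 0 / k.+2%:R -
    h^-1 *: (hadamard_quot k P G (h *: 1 + 0) - hadamard_quot k P G 0) =
    - (D / h ^+ k.+2).
  rewrite /hadamard_quot eqxx /GRing.scale /= mulr1 addr0 (negPf h0) /D !exprS.
  have : k.+1%:R != 0 :> R by rewrite pnatr_eq0.
  have : k.+2%:R != 0 :> R by rewrite pnatr_eq0.
  move: (k.+1%:R : R) (k.+2%:R : R) => a b b0 a0; field.
  by rewrite !expf_neq0 // b0 a0 h0.
rewrite normrN ED normrM normfV ler_pdivrMr ?normr_gt0 ?expf_neq0 //.
rewrite normrM normrX exprSr mulrA ler_wpM2r // exprSr mulrA [leRHS]mulrAC.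
rewrite mulrC normrM ler_pM //; last by rewrite normrX lerXn2r ?nnegrE.
apply: le_trans (G1 _ (le_lt_trans yh hr)) _.
by rewrite ler_wpM2l // ltW.
Qed.

(** Away from 0 the quotient rule gives a quotient of the same shape, with [k.+1] and [G'] in place
    of [k] and [G]; the value at 0 fits by the previous lemma. The family of quotients is thus
    closed under differentiation. *)
Lemma is_derive_hadamard_quot e k P G x : P 0 = 0 ->
  (forall x, `|x| < e -> is_derive x 1 P (x ^+ k * G x)) ->
  (forall x, `|x| < e -> derivable G x 1) -> `|x| < e ->
  is_derive x 1 (hadamard_quot k P G)
   (hadamard_quot k.+1 (fun x => x ^+ k.+1 * G x - k.+1%:R * P x) (derive1 G) x).
Proof.
move=> P0 dP dG xe; have e0 : 0 < e by exact: le_lt_trans xe.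
have [->|x0] := eqVneq x 0.
  rewrite {2}/hadamard_quot eqxx; apply: (is_derive_hadamard_quot0 e0 P0 dP).
  by apply: dG; rewrite normr0.
rewrite {2}/hadamard_quot (negPf x0).
have dPx := dP _ xe.
have x1 : x ^+ k.+1 != 0 by rewrite expf_neq0.
have dX : is_derive x 1 (fun y => y ^+ k.+1) (k.+1%:R * x ^+ k).
  have -> : (fun y : R => y ^+ k.+1) = (@id R) ^+ k.+1.
    by apply/funext => y; rewrite !fctE.
  by apply: is_derive_eq; rewrite /GRing.scale /= mulr1.
have dV : is_derive x 1 (fun y : R => (y ^+ k.+1)^-1)
    (- (x ^+ k.+1) ^- 2 *: (k.+1%:R * x ^+ k)) by exact: is_deriveV.
have := is_deriveM dPx dV.
set g := P * _; set g' := _ + _ => dg.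
have -> : x ^+ k.+1 * G x - k.+1%:R * P x = g' * x ^+ k.+2.
  rewrite /g' /GRing.scale /= !exprS; move: (k.+1%:R : R) => a; field.
  by rewrite !expf_neq0 // x0.
rewrite mulfK ?expf_neq0 //.
have nx0 : \forall y \near x, y != 0.
  exists `|x|; first by rewrite /= normr_gt0.
  move=> y; rewrite /ball /= => xy; apply: contraTneq xy => ->.
  by rewrite subr0 ltxx.
apply: near_eq_is_derive dg => //.
near=> y; rewrite /hadamard_quot /g !fctE.
by rewrite (negPf (_ : y != 0)) //; near: y.
Unshelve. all: by end_near. Qed.

Definition smooth_near0 f :=
  exists2 e, 0 < e & smooth_on (symint e) (fun u => f (u 0 0)).

Lemma smooth_near0_is_derive f :
  smooth_near0 f -> is_derive (0 : R) 1 f (derive1 f 0).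
Proof.
move=> [e e0 /(_ 1%N)/(kdiff_coordS _ _ f)[df _]].
rewrite derive1E; apply: DeriveDef => //.
by have := df (const_mx 0); rewrite /symint /= mxE normr0; apply.
Qed.

(** Induction on [j] for all [k], [P] and [G] at once: a derivative replaces them by [k.+1], [P1]
    and [G'], and [P1' = x ^ k.+1 * G']. *)
Lemma hadamard_quot_kdiff e j k P G :
  smooth_on (symint e) (fun u => G (u 0 0)) -> P 0 = 0 ->
  (forall x, `|x| < e -> is_derive x 1 P (x ^+ k * G x)) ->
  kdiff (symint e) j (fun u => hadamard_quot k P G (u 0 0)).
Proof.
elim: j k P G => // j IH k P G sG P0 dP.
have dG x : `|x| < e -> derivable G x 1.
  move=> xe; have [dG _] := (kdiff_coordS _ _ _).1 (sG 1%N).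
  by have := dG (const_mx x); rewrite /symint /= !mxE; apply.
have dQ := is_derive_hadamard_quot P0 dP dG.
apply/kdiff_coordS; split=> [u ue|]; first by have [] := dQ _ ue.
have sG' : smooth_on (symint e) (fun u => derive1 G (u 0 0)).
  by move=> i; have [_] := (kdiff_coordS _ _ _).1 (sG i.+1).
pose P1 x := x ^+ k.+1 * G x - k.+1%:R * P x.
have P10 : P1 0 = 0 by rewrite /P1 P0 mulr0 expr0n mul0r subr0.
have dP1 x : `|x| < e -> is_derive x 1 P1 (x ^+ k.+1 * derive1 G x).
  move=> xe; have dPx := dP _ xe.
  have dGx : is_derive x 1 G (derive1 G x).
    by rewrite derive1E; apply: DeriveDef => //; exact: dG.
  have -> : P1 = (@id R) ^+ k.+1 * G - k.+1%:R *: P.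
    by apply/funext => y; rewrite /P1 !fctE.
  apply: is_derive_eq.
  by rewrite /GRing.scale /= !fctE exprS; move: (k.+1%:R : R) => a; ring.
apply: kdiff_eq (IH k.+1 P1 (derive1 G) sG' P10 dP1).
  exact: symint_open.
by move=> u ue; rewrite derive1E; have [_ ->] := dQ _ ue.
Qed.

(** Take the quotient for [k = 0], [P = f - f 0] and [G = f']. The factorization holds at every [x],
    since away from 0 it is plain division; only the smoothness of [h] is local. *)
Lemma hadamard f : smooth_near0 f -> exists h, [/\ smooth_near0 h,
  h 0 = derive1 f 0 & forall x, f x = f 0 + x * h x].
Proof.
move=> [e e0 sf].
have sf' : smooth_on (symint e) (fun u => derive1 f (u 0 0)).
  by move=> i; have [_] := (kdiff_coordS _ _ _).1 (sf i.+1).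
exists (hadamard_quot 0 (fun x => f x - f 0) (derive1 f)); split.
- exists e => // k; apply: hadamard_quot_kdiff => //; first by rewrite subrr.
  move=> x xe; have [df _] := (kdiff_coordS _ _ _).1 (sf 1%N).
  have dfx : is_derive x 1 f (derive1 f x).
    rewrite derive1E; apply: DeriveDef => //.
    by have := df (const_mx x); rewrite /symint /= !mxE; apply.
  have -> : (fun x => f x - f 0) = f - cst (f 0) by [].
  by apply: is_derive_eq; rewrite subr0 mul1r.
- by rewrite /hadamard_quot eqxx divr1.
- move=> x; rewrite /hadamard_quot expr1; have [->|x0] := eqVneq x 0.
    by rewrite mul0r addr0.
  by field.
Qed.

End OneVariable.

(** * Plots, D-topology and germs of the bouquet *)

Section BouquetGerms.
Variable R : realType.

Local Notation X := (bouquet R).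
Local Notation O := (wedge_point R).

Definition branch_rep (n : nat) (t : R) :
    {classic coprod_space (fun _ : nat => real_space R)} :=
  existT (fun _ => R) n t.

Definition branch (n : nat) (t : R) : X :=
  (\pi_({eq_quot wedge_equiv R}) (branch_rep n t))%qT.

Lemma branchP n m t s : branch n t = branch m s <->
  (n = m /\ t = s) \/ (t = 0 /\ s = 0).
Proof.
split.
  move=> /eqmodP/asboolP[E|]; last by right.
  left; split; first exact: (congr1 (@projT1 nat (fun _ => R)) E).
  have : existT (fun _ : nat => R) n t = existT (fun _ : nat => R) m s by exact: E.
  move=> {}E; have nm := congr1 (@projT1 nat (fun _ => R)) E; simpl in nm; subst.
  exact: (congr1 (fun z : {i : nat & R} => projT2 z) E).
move=> H; apply/eqmodP/asboolP; case: H => [[-> ->]|[-> ->]]; [by left|by right].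
Qed.

Lemma branch0 n : branch n 0 = O.
Proof. by apply/(branchP n 0 0 0); right. Qed.

Lemma branch_ind (A : X -> Prop) : (forall n t, A (branch n t)) ->
  forall y, A y.
Proof. by move=> H; elim/quotW => -[n t]; exact: H. Qed.

Lemma branch_plot m (U : set 'rV[R]_m) n (q : U -> R) :
  @is_plot R (real_space R) _ _ q -> @is_plot R X _ _ (fun u => branch n (q u)).
Proof.
move=> pq; have oU := plot_open pq; split=> // u.
exists U, (@subset_refl _ U), (fun v => branch_rep n (q v)).
split=> //; [exact: set_valP| |].
  split=> // v; exists U, (@subset_refl _ U), n, q.
  split=> //; first exact: set_valP.
  by move=> w; have -> : subincl (@subset_refl _ U) w = w by exact: val_inj.
by move=> v; have -> : subincl (@subset_refl _ U) v = v by exact: val_inj.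
Qed.

(** A plot lifts locally to the coproduct, and there it locally stays in one summand; even near a
    parameter sent to the wedge point it runs in a single branch. *)
Lemma bouquet_plot m (U : set 'rV[R]_m) (p : U -> X) (u : U) :
  is_plot p -> exists (V : set 'rV[R]_m) (VU : V `<=` U) n (q : V -> R),
  [/\ open V, V (\val u), @is_plot R (real_space R) _ _ q &
    forall v, p (subincl VU v) = branch n (q v)].
Proof.
move=> [oU /(_ u)[V [VU [q [oV Vu [_ pq] E]]]]].
have [W [WV [n [r [oW Wu pr E']]]]] := pq (SigSub (mem_set Vu)).
exists W, (subset_trans WV VU), n, r; split=> // w.
rewrite /branch /branch_rep -E' -E; congr p; exact: val_inj.
Qed.

Lemma D_open_branch (A : set X) : D_open A ->
  forall n, open [set t | A (branch n t)].
Proof.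
move=> oA n; pose q (u : [set: 'rV[R]_1]) : R := \val u 0 0.
have pq : @is_plot R (real_space R) _ _ q.
  split; first exact: openT.
  by exists (fun u => u 0 0) => // k; exact: kdiff_coord openT.
have -> : [set t | A (branch n t)] = (fun t => t *: const_mx 1) @^-1`
    [set x | exists2 u : [set: 'rV[R]_1], \val u = x & A (branch n (q u))].
  apply/seteqP; split=> [t At|t [u]].
    exists (SigSub (mem_set (I : [set: 'rV[R]_1] (t *: const_mx 1)))) => //.
    by rewrite /q /= !mxE mulr1.
  by rewrite /q /= => ->; rewrite !mxE mulr1.
have /continuousP : continuous (fun t : R => t *: (const_mx 1 : 'rV[R]_1)).
  exact: scalel_continuous.
by apply; exact: oA _ _ _ (branch_plot n pq).
Qed.

Lemma D_openP (A : set X) : (forall n, open [set t | A (branch n t)]) -> D_open A.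
Proof.
move=> oA m U p pp; rewrite openE => _ [u <- Au].
have [V [VU [n [q [oV Vu [_ [F sF qF]] E]]]]] := bouquet_plot u pp.
have Fu : A (branch n (F (\val u))).
  have := E (SigSub (mem_set Vu)); rewrite qF /= => <-.
  by congr (A (p _)): Au; exact: val_inj.
have cF : {for \val u, continuous F}.
  have [dF _] := sF 1%N; exact/differentiable_continuous/dF.
have := cF _ (open_nbhs_nbhs (conj (oA n) Fu)).
have VV : nbhs (\val u) V by exact: open_nbhs_nbhs.
move=> FA; rewrite /interior; near=> v.
have Vv : V v by near: v.
exists (subincl VU (SigSub (mem_set Vv))) => //.
by rewrite E qF /=; near: v.
Unshelve. all: by end_near. Qed.

(** For positive [e] these sets form a neighbourhood basis at the wedge point; the radii need not be
    bounded below. *)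
Definition star (e : nat -> R) : set X :=
  [set y | exists n t, `|t| < e n /\ y = branch n t].

Lemma starE e n t : (forall n, 0 < e n) -> star e (branch n t) <-> `|t| < e n.
Proof.
move=> e0; split=> [[m [s [se /branchP[[-> ->] //|[-> _]]]]]|te].
  by rewrite normr0.
by exists n, t.
Qed.

Lemma D_open_star e : (forall n, 0 < e n) -> D_open (star e).
Proof.
move=> e0; apply: D_openP => n.
suff -> : [set t | star e (branch n t)] = ball (0 : R) (e n) by exact: ball_open.
by apply/seteqP; split=> t; rewrite /ball /= sub0r normrN => /starE; apply.
Qed.

Lemma star0 e : (forall n, 0 < e n) -> star e O.
Proof. by move=> e0; rewrite -(branch0 0); apply/starE; rewrite ?normr0. Qed.

(** Radii chosen on each branch separately assemble into a star, which is D-open. Conditions near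
    the wedge point thus decouple over the branches. *)
Lemma D_nearP (A : set X) :
  D_near O A <-> forall n, \forall t \near (0 : R), A (branch n t).
Proof.
split=> [[W [oW WO WA] n]|nA].
  have W0 : [set t | W (branch n t)] 0 by rewrite /= branch0.
  have := open_nbhs_nbhs (conj (@D_open_branch W oW n) W0).
  by apply: filterS => t; exact: WA.
have /choice[e eP] : forall n, exists e : R, 0 < e /\
    forall t, `|t| < e -> A (branch n t).
  move=> n; have [e /= e0 eA] := nA n; exists e; split=> // t te; apply: eA.
  by rewrite /ball /= sub0r normrN.
exists (star e); split; first by apply: D_open_star => n; exact: (eP n).1.
- by apply: star0 => n; exact: (eP n).1.
- by move=> _ [n [t [te ->]]]; exact: (eP n).2.
Qed.

(** Read off the chosen representative. At the wedge point this may lie on any branch, hence the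
    condition on [f n 0] in [branchwiseE]. *)
Definition branchwise (f : nat -> R -> R) (y : X) : R :=
  f (projT1 (repr y)) (projT2 (repr y)).

Lemma branchwiseE f n t : (forall n m, f n 0 = f m 0) ->
  branchwise f (branch n t) = f n t.
Proof.
move=> f0; rewrite /branchwise.
have : branch (projT1 (repr (branch n t))) (projT2 (repr (branch n t))) =
    branch n t.
  by rewrite /branch /branch_rep; case: (repr _) (reprK (branch n t)).
by case/branchP => [[-> ->]|[-> ->]].
Qed.

Lemma smooth_fct_near m (U : set 'rV[R]_m) (p : U -> R) :
  (forall u : U, exists (V : set 'rV[R]_m) (VU : V `<=` U),
     [/\ open V, V (\val u) & smooth_fct (p \o subincl VU)]) -> smooth_fct p.
Proof.
move=> sp; pose I := {V : set 'rV[R]_m | exists VU : V `<=` U,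
  open V /\ smooth_fct (p \o subincl VU)}.
have VU (i : I) : sval i `<=` U by have [] := svalP i.
apply: (@smooth_fct_local _ _ _ _ I (fun i => sval i) VU).
- by move=> i; have [? []] := svalP i.
- move=> x Ux; have [V [VU' [oV Vx sV]]] := sp (SigSub (mem_set Ux)).
  by exists (exist _ V (ex_intro _ VU' (conj oV sV))).
- move=> i; have [VU' [_]] := svalP i.
  by congr (smooth_fct (_ \o _)); apply/funext => x; exact: val_inj.
Qed.

(** Restrict [f] to the star whose radii are those of smoothness on the branches: a plot of this
    star locally runs in one branch, where [f] is smooth. *)
Lemma germ_like_branchwise (f : X -> R) :
  (forall n, smooth_near0 (fun t => f (branch n t))) ->
  exists g : germ O, germ_like g f.
Proof.
move=> sf.
have /choice[e eP] : forall n, exists e : R, 0 < e /\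
    smooth_on (symint e) (fun u => f (branch n (u 0 0))).
  by move=> n; have [e e0 se] := sf n; exists e.
have e0 n : 0 < e n by exact: (eP n).1.
have sB : @smooth R (subset_space (star e)) (real_space R) (f \o \val).
  move=> m U p pp; split; first exact: plot_open pp.
  apply: smooth_fct_near => u.
  have [V [VU [n [q [oV Vu [_ [Q sQ qQ]] E]]]]] := bouquet_plot u pp.
  exists V, VU; split=> //; exists (fun v => f (branch n (Q v))).
    move=> k; have -> : (fun v => f (branch n (Q v))) =
      (fun u : 'rV[R]_1 => f (branch n (u 0 0))) \o (fun v => const_mx (Q v)).
      by apply/funext => v /=; rewrite mxE.
    apply: kdiff_comp ((eP n).2 k) => //.
      move=> v Vv; rewrite /symint /= mxE; apply/starE => //.
      have := E (SigSub (mem_set Vv)); rewrite qQ /= => <-.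
      exact: set_valP.
    by move=> j; have -> : (fun x => (const_mx (Q x) : 'rV[R]_1) 0 j) = Q
      by apply/funext => x; rewrite mxE.
  by move=> v /=; rewrite E qQ.
pose B : D_nbhd O := exist _ (star e) (conj (D_open_star e0) (star0 e0)).
pose a : local_space O := existT _ B (exist _ _ sB).
exists (germ_of a), a => //; exists (star e); split.
- exact: D_open_star.
- exact: star0.
- move=> y ey; have := local_extE (SigSub (mem_set ey) : local_dom a).
  by move=> /= <-.
Qed.

Lemma local_ext_smooth (a : local_space O) n :
  smooth_near0 (fun t => local_ext a (branch n t)).
Proof.
have [e /= e0 ea] := (D_nearP _).1 (D_near_dom a) n.
have {}ea (u : symint e) : local_dom a (branch n (\val u 0 0)).
  by apply: ea; rewrite /ball /= sub0r normrN; exact: (set_valP u).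
exists e => //.
pose p (u : symint e) : local_dom a := SigSub (mem_set (ea u)).
have pp : @is_plot R (subset_space (local_dom a)) _ _ p.
  apply: branch_plot; split; first exact: symint_open.
  by exists (fun u => u 0 0) => // k; apply: kdiff_coord; exact: symint_open.
have [_ [F sF pF]] := svalP (projT2 a) _ _ _ pp.
move=> k; apply: kdiff_eq (sF k); first exact: symint_open.
move=> u ue; have := pF (SigSub (mem_set ue)); rewrite /= => <-.
exact: (local_extE (p (SigSub (mem_set ue)))).
Qed.

Lemma smooth_near0_eq (f g : R -> R) : (\forall t \near (0 : R), f t = g t) ->
  smooth_near0 f -> smooth_near0 g.
Proof.
move=> [d /= d0 fg] [e e0 sf]; exists (Num.min d e); first by rewrite lt_min d0.
move=> k; apply: (@kdiff_eq _ _ _ _ (fun u => f (u 0 0))).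
- exact: symint_open.
- move=> u; rewrite /symint /= lt_min => /andP[ud _]; apply: fg.
  by rewrite /ball /= sub0r normrN.
- apply: kdiff_sub (sf k) => u; rewrite /symint /= lt_min => /andP[]//.
Qed.

Lemma germ_like_smooth (g : germ O) f n : germ_like g f ->
  smooth_near0 (fun t => f (branch n t)).
Proof.
move=> [a _ /D_nearP/(_ n) af].
exact: smooth_near0_eq af (local_ext_smooth a n).
Qed.

Lemma germ_like_unique (g : germ O) f f' : germ_like g f -> germ_like g f' ->
  forall n, \forall t \near (0 : R), f (branch n t) = f' (branch n t).
Proof.
move=> [a -> af] [b /germ_ofP ab bf'].
apply/(D_nearP (fun y => f y = f' y)).
by apply: D_nearS (D_nearI af (D_nearI ab bf')) => y [<- [-> ->]].
Qed.

Lemma germ_like_val (g : germ O) f : germ_like g f -> germ_val g = f O.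
Proof.
by move=> [a -> [W [_ WO /(_ _ WO) af]]]; rewrite germ_val_local_ext af.
Qed.

(** Computed on the chosen representative, extended by 0 outside its domain; by [slopeE] any
    function with this germ gives the same value. *)
Definition slope (g : germ O) (n : nat) : R^o :=
  derive1 (fun t => local_ext (repr g) (branch n t)) 0.

Lemma slopeE (g : germ O) f n : germ_like g f ->
  slope g n = derive1 (fun t => f (branch n t)) 0.
Proof.
move=> gf; rewrite /slope !derive1E; apply: near_eq_derive => //.
have gr : germ_like g (local_ext (repr g)).
  exists (repr g); last exact: D_nearT.
  by rewrite /germ_of reprK.
exact: germ_like_unique gr gf n.
Qed.

End BouquetGerms.
Arguments branch0 {R} n.

(** * Linear germs, and derivations as functions of the slopes *)

Section BouquetTangent.
Variable R : realType.

Local Notation X := (bouquet R).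
Local Notation O := (wedge_point R).
Implicit Types (c d : nat -> R^o) (g h : germ O).

Definition lin c : X -> R := branchwise (fun n t => c n * t).

Lemma linE c n t : lin c (branch n t) = c n * t.
Proof. by rewrite /lin branchwiseE // => i j; rewrite !mulr0. Qed.

(** Locally the second component of a plot runs in one branch [n], where only the coefficient
    [c u n] is seen, so smoothness of each coefficient suffices without uniformity in [n]. This
    turns smooth families of sequences into plots of germs. *)
Lemma lin_smooth_family m (U : set 'rV[R]_m) (c : U -> nat -> R^o) :
  (forall n, smooth_fct (fun u => c u n)) ->
  @smooth R (prod_space (@subset_space R (euclidean_space R m) U)
                        (@subset_space R X [set: X]))
    (real_space R) (fun ux => lin (c ux.1) (\val ux.2)).
Proof.
move=> sc l W q [q1 q2]; have oW := plot_open q2; split=> //.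
apply: smooth_fct_near => w.
have [V [VW [n [r [oV Vw [_ sr] E]]]]] := bouquet_plot w q2.
exists V, VW; split=> //.
have -> : (fun ux => lin (c ux.1) (\val ux.2)) \o q \o subincl VW =
    fun v => c (q (subincl VW v)).1 n * r v.
  by apply/funext => v /=; rewrite E linE.
apply: smooth_fctM => //.
apply: (@smooth_fct_comp _ _ _ _ _ (fun u => c u n)
  (fun v => (q (subincl VW v)).1)) => //.
have [_ sq] := q1.
by apply: (@smooth_vect_comp _ _ _ _ _ _ _ (subincl VW) oV sq);
  exact: smooth_vect_subincl.
Qed.

Fact lin_smooth c :
  @smooth R (@subset_space R X [set: X]) (real_space R) (fun y => lin c (\val y)).
Proof.
move=> m U p pp; have oU := plot_open pp.
apply: (@lin_smooth_family m U (fun=> c) _ _ _ (fun u => (u, p u))).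
  by move=> n; exact: smooth_fct_cst.
split=> //; split=> //; move=> j; exists (fun x => x 0 j) => // k.
exact: kdiff_coord.
Qed.

Definition lin_local c : local_space O :=
  existT _ (D_nbhdT O) (exist _ _ (@lin_smooth c)).

Definition lin_germ c : germ O := germ_of (lin_local c).

Lemma like_lin c : germ_like (lin_germ c) (lin c).
Proof.
exists (lin_local c) => //; apply: D_nearT => y.
have := local_extE (SigSub (@mem_set _ [set: X] y I) : local_dom (lin_local c)).
by move=> /= <-.
Qed.

Lemma slope_lin c : slope (lin_germ c) = c.
Proof.
apply/funext => n; rewrite (slopeE n (like_lin c)).
have -> : (fun t => lin c (branch n t)) = c n *: (@id R).
  by apply/funext => t; rewrite linE.
by rewrite derive1E derive_val /GRing.scale /= mulr1.
Qed.

Lemma lin_germ_linear a c d :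
  lin_germ (a *: c + d) = a *: lin_germ c + lin_germ d.
Proof.
apply: like_eq (like_lin _)
  (like_add (like_mul (like_cst O a) (like_lin c)) (like_lin d)) _ => y.
by elim/branch_ind: y => n t; rewrite !linE mulrDl mulrA.
Qed.

Lemma germ_like_is_derive g f n : germ_like g f ->
  is_derive (0 : R) 1 (fun t => f (branch n t)) (slope g n).
Proof.
move=> gf; rewrite (slopeE n gf); apply: smooth_near0_is_derive.
exact: germ_like_smooth gf.
Qed.

Lemma slope_linear a g h : slope (a *: g + h) = a *: slope g + slope h.
Proof.
apply/funext => n.
have [p gp] := like_ex g; have [q hq] := like_ex h.
rewrite (slopeE n (like_add (like_mul (like_cst O a) gp) hq)).
have dp := germ_like_is_derive n gp; have dq := germ_like_is_derive n hq.
have -> : (fun t => a * p (branch n t) + q (branch n t)) =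
  a *: (fun t => p (branch n t)) + (fun t => q (branch n t)) by [].
by rewrite derive1E derive_val.
Qed.

Lemma slopeM g h n :
  slope (g * h) n = germ_val g * slope h n + germ_val h * slope g n.
Proof.
have [p gp] := like_ex g; have [q hq] := like_ex h.
rewrite (slopeE n (like_mul gp hq)).
have dp := germ_like_is_derive n gp; have dq := germ_like_is_derive n hq.
have -> : (fun t => p (branch n t) * q (branch n t)) =
  (fun t => p (branch n t)) * (fun t => q (branch n t)) by [].
rewrite derive1E derive_val branch0.
by rewrite (germ_like_val gp) (germ_like_val hq).
Qed.

(** By Hadamard's lemma, [f] on branch [n] is [f O + slope g n * t + t * (h n t - h n 0)]. A
    derivation kills the constant, because [D 1 = D 1 + D 1], and the last term, a product of two
    germs vanishing at the wedge point. *)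
Lemma right_tangent_lin (D : right_tangent O) g : D g = D (lin_germ (slope g)).
Proof.
have /asboolP DM := right_tangentP D.
have D1 : D 1 = 0.
  have v1 : germ_val (1 : germ O) = 1 by exact: germ_like_val (like_cst O 1).
  have := DM 1 1; rewrite mulr1 v1 !mul1r => /eqP.
  by rewrite -subr_eq0 opprD addrA subrr sub0r oppr_eq0 => /eqP.
have [f gf] := like_ex g.
have /choice[h hP] n := hadamard (germ_like_smooth n gf).
(* Subtracting [h n 0] makes the branches agree at 0, so that the quotients glue. *)
pose k := branchwise (fun n t => h n t - h n 0).
have kE n t : k (branch n t) = h n t - h n 0.
  by rewrite /k branchwiseE // => i j; rewrite !subrr.
have [K Kk] : exists K : germ O, germ_like K k.
  apply: germ_like_branchwise => n; have [[e e0 sh] _ _] := hP n.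
  exists e => // i.
  have -> : (fun u : 'rV[R]_1 => k (branch n (u 0 0))) =
    fun u => h n (u 0 0) + - h n 0 by apply/funext => u; rewrite kE.
  apply: kdiffD; [exact: symint_open|exact: sh|].
  by apply: kdiff_cst; exact: symint_open.
have kO : germ_val K = 0 by rewrite (germ_like_val Kk) -(branch0 0) kE subrr.
have xO : germ_val (lin_germ (fun=> 1)) = 0.
  by rewrite (germ_like_val (like_lin _)) -(branch0 0) linE mulr0.
have E : g = f O *: 1 + (lin_germ (slope g) + lin_germ (fun=> 1) * K).
  have rhs := like_add (like_mul (like_cst O (f O)) (like_cst O 1))
    (like_add (like_lin (slope g)) (like_mul (like_lin (fun=> 1)) Kk)).
  apply: (like_eq gf rhs) => y.
  elim/branch_ind: y => n t; have [_ h0 ->] := hP n.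
  by rewrite !linE kE (slopeE n gf) -h0 branch0 mulr1 mul1r; ring.
rewrite {1}E linearP raddfD /= D1 scaler0 add0r.
by rewrite DM kO xO !mul0r !addr0.
Qed.

End BouquetTangent.

(** * Right tangent vectors as functionals on sequences *)

Section TangentDual.
Variable R : realType.

Local Notation X := (bouquet R).
Local Notation O := (wedge_point R).
Local Notation dual := (linear_map (nat -> R^o) R^o).
Implicit Types (c d : nat -> R^o) (g h : germ O).

Fact dual_of_tangent_linear (D : right_tangent O) :
  (fun c => D (lin_germ c)) \in @linear_pred R (nat -> R^o) R^o.
Proof. by apply/asboolP => a c d; rewrite lin_germ_linear linearP. Qed.

Definition dual_of_tangent (D : right_tangent O) : dual :=
  LinearMap (dual_of_tangent_linear D).

Fact dual_of_tangent_is_linear : linear dual_of_tangent.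
Proof. by move=> a D E; apply/val_inj/funext. Qed.

HB.instance Definition _ := GRing.isLinear.Build R (right_tangent O) dual
  *:%R dual_of_tangent dual_of_tangent_is_linear.

Fact tangent_of_dual_linear (phi : dual) :
  (fun g => phi (slope g)) \in @linear_pred R (germ O) R^o.
Proof. by apply/asboolP => a g h; rewrite slope_linear linearP. Qed.

Fact tangent_of_dual_leibniz (phi : dual) :
  LinearMap (tangent_of_dual_linear phi) \in @leibniz_pred R X O.
Proof.
apply/asboolP => g h /=.
have -> : slope (g * h) = germ_val g *: slope h + germ_val h *: slope g.
  by apply/funext => n; rewrite slopeM.
by rewrite linearP linearZ.
Qed.

Definition tangent_of_dual (phi : dual) : right_tangent O :=
  RightTangent (tangent_of_dual_leibniz phi).

Lemma dual_of_tangentK : cancel dual_of_tangent tangent_of_dual.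
Proof.
move=> D; apply/val_inj/val_inj/funext => g /=.
by rewrite -right_tangent_lin.
Qed.

Lemma tangent_of_dualK : cancel tangent_of_dual dual_of_tangent.
Proof. by move=> phi; apply/val_inj/funext => c /=; rewrite slope_lin. Qed.

Fact coordinate_linear n :
  (fun c => c n) \in @linear_pred R (nat -> R^o) R^o.
Proof. by apply/asboolP. Qed.

Definition coordinate n : dual := LinearMap (coordinate_linear n).

(** A plot of germs is locally a smooth family of functions on one neighbourhood [B]. On branch [n]
    it becomes a smooth function [F] of the parameter and [t], and the slope is the partial
    derivative of [F] in [t] at 0. *)
Lemma smooth_slope n : tangent_of_dual (coordinate n) \in @smooth_derivation R X O.
Proof.
apply/asboolP => m U p [oU lp]; split=> //.
apply: smooth_fct_near => u.
have [V [VU [q [oV Vu [_ lq] pE]]]] := lp u.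
have [W [WV [B [r [oW Wu [_ sr] qE]]]]] := lq (SigSub (mem_set Vu)).
exists W, (subset_trans WV VU); split=> //.
have oB : open [set t | (sval B) (branch n t)].
  by apply: D_open_branch; exact: (svalP B).1.
have B0 : sval B (branch n 0) by rewrite branch0; exact: (svalP B).2.
pose T : set 'rV[R]_(m + 1) :=
  [set w | W (lsubmx w) /\ sval B (branch n (w 0 (rshift m 0)))].
have oT : open T.
  apply: openI.
    have /continuousP : continuous (@lsubmx R 1 m 1) by
      move=> x; apply/differentiable_continuous/differentiable_vect => j;
      rewrite (_ : (fun y => _) = fun y : 'rV[R]_(m + 1) => y 0 (lshift 1 j));
      [exact: differentiable_coord|by apply/funext => y; rewrite mxE].
    by apply.
  have /continuousP : continuous (fun w : 'rV[R]_(m + 1) => w 0 (rshift m 0)).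
    exact: coord_continuous.
  by move=> /(_ _ oB).
pose tl (w : T) : W := SigSub (mem_set (set_valP w).1).
pose tr (w : T) : sval B := SigSub (mem_set (set_valP w).2).
have tp : @is_plot R (prod_space (@subset_space R (euclidean_space R m) W)
    (@subset_space R X (sval B))) _ T (fun w => (tl w, tr w)).
  split.
    split=> // j; exists (fun w => w 0 (lshift 1 j)).
      by move=> k; exact: kdiff_coord.
    by move=> w; rewrite /tl /= mxE.
  apply: branch_plot; split=> //.
  by exists (fun w => w 0 (rshift m 0)) => // k; exact: kdiff_coord.
have [_ [F sF FE]] := sr _ _ _ tp.
pose d : 'rV[R]_(m + 1) := delta_mx 0 (rshift m 0).
exists (fun w => 'D_d F (row_mx w 0)).
  move=> k; apply: (kdiff_comp (V := T) (g := fun x => 'D_d F x)) => //.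
  - by move=> w Ww; rewrite /T /= row_mxKl row_mxEr mxE.
  - move=> j; case: (split_ordP j) => i ->.
      rewrite (_ : (fun x => _) = fun x : 'rV[R]_m => x 0 i).
        exact: kdiff_coord.
      by apply/funext => x; rewrite row_mxEl.
    rewrite (_ : (fun x => _) = cst 0); first exact: kdiff_cst.
    by apply/funext => x; rewrite row_mxEr mxE.
  (* Smoothness of a partial derivative is the second half of [kdiff] one order higher. *)
  - by have [_ ] := sF k.+1; apply.
move=> w /=.
have -> : p (subincl (subset_trans WV VU) w) =
    germ_of (existT _ B (r w) : local_space O).
  rewrite /germ_of -qE -pE; congr p; exact: val_inj.
set a := (existT _ B (r w) : local_space O).
have al : germ_like (germ_of a) (local_ext a).
  by exists a => //; exact: D_nearT.
rewrite (slopeE n al) derive1E.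
have Tw : T (row_mx (\val w) 0).
  by rewrite /T /= row_mxKl row_mxEr mxE; split => //; exact: set_valP.
have aF : \forall t \near (0 : R),
    local_ext a (branch n t) = F (t *: d + row_mx (\val w) 0).
  have Bt : \forall t \near (0 : R), sval B (branch n t).
    exact: open_nbhs_nbhs (conj oB B0).
  apply: filterS Bt => t Bt.
  have E : t *: d + row_mx (\val w) 0 = row_mx (\val w) (const_mx t).
    apply/rowP => j; rewrite mxE [(t *: d) 0 j]mxE [d 0 j]mxE.
    case: (split_ordP j) => i ->.
      by rewrite eq_lrshift andbF mulr0 add0r !row_mxEl.
    by rewrite !row_mxEr eq_rshift !ord1 !mxE eqxx mulr1 addr0.
  have Tt : T (row_mx (\val w) (const_mx t)).
    by rewrite /T /= row_mxKl row_mxEr mxE; split => //; exact: set_valP.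
  have := FE (SigSub (mem_set Tt)); rewrite E /= => <-.
  set tlw := tl _; set trw := tr _.
  have -> : tlw = w by apply: val_inj; rewrite /= row_mxKl.
  rewrite -[RHS]/(local_fun (trw : local_dom a)) local_extE /=.
  by rewrite row_mxEr mxE.
transitivity ('D_1 (fun t : R => F (t *: d + row_mx (\val w) 0)) (0 : R)).
  exact: near_eq_derive.
have E : (fun h : R => h^-1 *: (((fun t : R => F (t *: d + row_mx (\val w) 0)) \o
      shift 0) (h *: 1) - F (0 *: d + row_mx (\val w) 0))) =
    (fun h : R => h^-1 *: ((F \o shift (row_mx (\val w) 0)) (h *: d) -
      F (row_mx (\val w) 0))).
  by apply/funext => h /=; rewrite [h *: 1]mulr1 addr0 scale0r add0r.
by rewrite /derive E.
Qed.

End TangentDual.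

(** * Smooth derivations depend on finitely many slopes *)

Section ExternalTangent.
Variable R : realType.

Local Notation X := (bouquet R).
Local Notation O := (wedge_point R).
Local Notation dual := (linear_map (nat -> R^o) R^o).
Implicit Types (c d : nat -> R^o) (g h : germ O).

(** All the functions [lin (c t)] live on the whole space, so the curve of germs lifts to one
    summand of the coproduct and is a plot; [D] then becomes a smooth function of [t]. *)
Lemma smooth_derivation_curve (D : right_tangent O) (c : R -> nat -> R^o) :
  D \in @smooth_derivation R X O ->
  (forall n, smooth_on [set: 'rV[R]_1] (fun u => c (u 0 0) n)) ->
  continuous (fun t => D (lin_germ (c t))).
Proof.
move=> /asboolP sD sc.
pose q (u : [set: 'rV[R]_1]) : local_space O := lin_local (c (\val u 0 0)).
have oT : open [set: 'rV[R]_1] by exact: openT.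
have pq : @is_plot R (germ_space O) _ [set: 'rV[R]_1] (fun u => germ_of (q u)).
  split=> // u; exists setT, (@subset_refl _ setT), q; split=> //.
  split=> // v; exists setT, (@subset_refl _ setT), (D_nbhdT O).
  pose r (w : [set: 'rV[R]_1]) :
      fun_space (@subset_space R X [set: X]) (real_space R) :=
    exist _ _ (@lin_smooth R (c (\val w 0 0))).
  exists r; split=> //.
  split=> //; apply: (@lin_smooth_family R 1 setT (fun u => c (\val u 0 0))).
  by move=> n; exists (fun u => c (u 0 0) n).
have [_ [F sF FE]] := sD _ _ _ pq.
have -> : (fun t => D (lin_germ (c t))) = F \o (fun t => t *: const_mx 1).
  apply/funext => t.
  have := FE (SigSub (@mem_set _ [set: 'rV[R]_1] (t *: const_mx 1) I)).
  by rewrite /= /q /= !mxE mulr1 => <-.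
move=> t; apply: continuous_comp; first exact: scalel_continuous.
by have [dF _] := sF 1%N; exact/differentiable_continuous/dF.
Qed.

(* Newton interpolation at the points [1 / (i + 1)]: [newton phi e M] is a curve
   in the span of [e 0, ..., e (M - 1)] on which [phi] takes the value [i] at
   [1 / (i + 1)]. *)
Fixpoint newton (phi : dual) (e : nat -> nat -> R^o) (M : nat) (t : R) :
    nat -> R^o :=
  if M is i.+1 then newton phi e i t +
    ((\prod_(j < i) (t - harmonic j)) *
     ((i%:R - phi (newton phi e i (harmonic i))) /
      (\prod_(j < i) (harmonic i - harmonic j) * phi (e i)))) *: e i
  else 0.

Lemma newtonS phi e i t : newton phi e i.+1 t = newton phi e i t +
    ((\prod_(j < i) (t - harmonic j)) *
     ((i%:R - phi (newton phi e i (harmonic i))) /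
      (\prod_(j < i) (harmonic i - harmonic j) * phi (e i)))) *: e i.
Proof. by []. Qed.

Section Newton.
Variables (phi : dual) (e : nat -> nat -> R^o).
Hypotheses (phie : forall i, phi (e i) != 0)
  (e0 : forall i n, (n < i)%N -> e i n = 0).

(** The coefficient of [e M] is solved from the value wanted at [harmonic M]; this is possible as
    the nodes are distinct and [phi (e M)] is nonzero. *)
Lemma newton_val M : phi (newton phi e M.+1 (harmonic M)) = M%:R.
Proof.
have phiD a c d : phi (c + a *: d) = phi c + a * phi d.
  by rewrite addrC linearP addrC.
rewrite newtonS phiD.
have : \prod_(j < M) (harmonic M - harmonic j) != 0 :> R.
  apply/prodf_neq0 => j _; rewrite subr_eq0 /harmonic /=.
  by rewrite (inj_eq invr_inj) eqr_nat eqSS gtn_eqF.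
move: (\prod_(j < M) _) => P P0; move: (phi (e M)) (phie M) => z z0.
by field; rewrite z0.
Qed.

(** The later vectors [e i] have zero [n]-th coordinate. *)
Lemma newton_stable_coord n k t :
  newton phi e (n.+1 + k) t n = newton phi e n.+1 t n.
Proof.
elim: k => [|k IH]; first by rewrite addn0.
rewrite addnS -IH newtonS !fctE e0 ?scaler0 ?addr0 //.
exact: leq_addr.
Qed.

(** The later terms contain the factor [t - harmonic M]. *)
Lemma newton_stable_pt M k :
  newton phi e (M.+1 + k) (harmonic M) = newton phi e M.+1 (harmonic M).
Proof.
elim: k => [|k IH]; first by rewrite addn0.
rewrite addnS -IH newtonS.
have M1 : (M < M.+1 + k)%N by exact: leq_addr.
by rewrite (bigD1 (Ordinal M1)) //= subrr !mul0r scale0r addr0.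
Qed.

Lemma newton_smooth M n :
  smooth_on [set: 'rV[R]_1] (fun u => newton phi e M (u 0 0) n).
Proof.
move=> k; have oT : open [set: 'rV[R]_1] by exact: openT.
elim: M => [|M IH]; first exact: kdiff_cst.
apply: kdiffD => //; apply: kdiffM; [exact: oT| |exact: kdiff_cst].
apply: kdiffM; [exact: oT| |exact: kdiff_cst].
elim: M {IH} => [|M IH].
  rewrite (_ : (fun u => _) = cst 1); first exact: kdiff_cst.
  by apply/funext => u; rewrite big_ord0.
rewrite (_ : (fun u => _) = fun u : 'rV[R]_1 =>
  \prod_(j < M) (u 0 0 - harmonic j) * (u 0 0 + - harmonic M)); last first.
  by apply/funext => u; rewrite big_ord_recr.
apply: kdiffM => //; apply: kdiffD => //; last exact: kdiff_cst.
exact: kdiff_coord.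
Qed.

(** The whole Newton series, summed coordinatewise: coordinate [n] receives only the terms of
    [e 0, ..., e n], so it is a polynomial in [t]. *)
Definition newton_limit t n := newton phi e n.+1 t n.

(** At the node [harmonic M] the terms beyond [e M] vanish, so the series is a finite combination
    and linearity of [phi] gives its value. *)
Lemma newton_limit_harmonic M : phi (newton_limit (harmonic M)) = M%:R.
Proof.
rewrite -newton_val; congr (phi _); apply/funext => n; rewrite /newton_limit.
have [nM|Mn] := leqP n M.
  have -> : M.+1 = (n.+1 + (M - n))%N by rewrite addSn subnKC.
  by rewrite newton_stable_coord.
have -> : n.+1 = (M.+1 + (n - M))%N by rewrite addSn subnKC // ltnW.
by rewrite newton_stable_pt.
Qed.

End Newton.

(** Otherwise each [N] has a sequence [e N], zero below [N], on which [D] does not vanish. Along the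
    Newton curve [D] then takes the value [M] at [harmonic M], against continuity at 0. *)
Lemma smooth_derivation_tail (D : right_tangent O) :
  D \in @smooth_derivation R X O ->
  exists N, forall c, (forall n, (n < N)%N -> c n = 0) -> D (lin_germ c) = 0.
Proof.
move=> sD; apply: contrapT => noN.
have /choice[e eP] : forall N, exists c : nat -> R^o,
    (forall n, (n < N)%N -> c n = 0) /\ dual_of_tangent D c != 0.
  move=> N; apply: contrapT => noc; apply: noN; exists N => c c0.
  by apply: contrapT => Dc; apply: noc; exists c; split=> //; exact/eqP.
pose phi := dual_of_tangent D; pose c := newton_limit phi e.
have sc n : smooth_on [set: 'rV[R]_1] (fun u => c (u 0 0) n).
  exact: newton_smooth.
have := cvg_comp _ _ (@cvg_harmonic R) (@smooth_derivation_curve D c sD sc 0).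
move=> /cvgrPdist_lt/(_ _ ltr01)[N _ NP].
have E M : D (lin_germ (c (harmonic M))) = M%:R.
  exact: (@newton_limit_harmonic phi e (fun i => (eP i).2) (fun i => (eP i).1)).
(* The values [N] and [N + 2] cannot both lie within 1 of the limit. *)
have := NP N (leqnn N); have := NP (N + 2)%N (leq_addr _ _).
rewrite /= !E natrD !ltr_norml => /andP[] + _ => /[swap] /andP[_].
lra.
Qed.

Definition external_coordinates (D : external_tangent O) : nat -> R^o :=
  fun n => D (lin_germ (fun m => (m == n)%:R)).

Lemma lin_germ_split c N :
  lin_germ c = \sum_(n < N) c n *: lin_germ (fun m => (m == n)%:R) +
               lin_germ (fun n => if (n < N)%N then 0 else c n).
Proof.
elim: N => [|N IH]; first by rewrite big_ord0 add0r.
rewrite {1}IH big_ord_recr /= -addrA; congr (_ + _).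
rewrite -lin_germ_linear; congr lin_germ; apply/funext => n.
rewrite !fctE /GRing.scale /= ltnS [(n <= N)%N]leq_eqVlt.
case: eqP => [->|_] /=; first by rewrite ltnn mulr1 addr0.
by rewrite mulr0 add0r.
Qed.

Fact external_coordinates_finsupp (D : external_tangent O) :
  external_coordinates D \in @finsupp_pred R nat.
Proof.
apply/asboolP; have [N DN] := smooth_derivation_tail (external_tangentP D).
apply: sub_finite_set (finite_II N) => n /=; apply: contraNltn => Nn.
by apply/eqP/DN => m mN; rewrite ltn_eqF // (leq_trans mN).
Qed.

Definition sum_of_external (D : external_tangent O) : direct_sum R nat :=
  DirectSum (external_coordinates_finsupp D).

Fact sum_of_external_is_linear : linear sum_of_external.
Proof. by move=> a D E; apply/val_inj/funext. Qed.

HB.instance Definition _ := GRing.isLinear.Build R (external_tangent O)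
  (direct_sum R nat) *:%R sum_of_external sum_of_external_is_linear.

(** Injectivity: beyond a common bound both derivations ignore the sequence, so finitely many
    coordinates determine them. Surjectivity: finite combinations of coordinate derivations are
    smooth by [smooth_slope]. *)
Lemma sum_of_external_bij : bijective sum_of_external.
Proof.
rewrite -setTT_bijective; split=> //.
  move=> D E _ _ DE; apply/val_inj; apply: (can_inj (@dual_of_tangentK R)).
  apply/val_inj/funext => c /=.
  have [N DN] := smooth_derivation_tail (external_tangentP D).
  have [M EM] := smooth_derivation_tail (external_tangentP E).
  rewrite (lin_germ_split c (maxn N M)).
  rewrite !raddfD /= DN ?EM ?addr0.
  - rewrite !linear_sum; apply: eq_bigr => n _; rewrite !linearZ /=.
    congr (_ *: _); exact: (congr1 (fun s : direct_sum R nat => s n) DE).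
  - by move=> n nM; rewrite leq_max nM orbT.
  - by move=> n nN; rewrite leq_max nN.
move=> a _.
have [s sP] : exists s : seq nat, forall n, a n != 0 -> n \in s.
  have /asboolP/finite_seqP[s sE] := direct_sumP a.
  by exists s => n an; have : [set i | a i != 0] n by []; rewrite sE.
pose D := \sum_(n <- undup s) a n *: tangent_of_dual (coordinate R n).
have sD : D \in @smooth_derivation R X O.
  by apply: rpred_sum => n _; apply: rpredZ; exact: smooth_slope.
exists (ExternalTangent sD) => //.
apply/val_inj/funext => n; rewrite -[LHS]/(D (lin_germ (fun m => (m == n)%:R))).
set g := lin_germ _.
have -> : D g = \sum_(i <- undup s) a i *: slope g i.
  by rewrite /D; elim/big_rec2 : _ => // i x F _ <-.
rewrite slope_lin.
have sn i : i != n -> a i *: ((i == n)%:R : R^o) = 0.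
  by move=> /negPf ->; rewrite scaler0.
have [ns|ns] := boolP (n \in undup s).
  rewrite (bigD1_seq n) ?undup_uniq //= eqxx big1 ?addr0 => [|i /sn //].
  by rewrite /GRing.scale /= mulr1.
rewrite big1_seq => [|i /= iS]; last first.
  by apply: sn; apply: contraNneq ns => <-.
apply/esym/eqP; apply: contraNT ns => /sP.
by rewrite mem_undup.
Qed.

End ExternalTangent.

(** * Separating functionals and Hamel bases by Zorn's lemma *)

Section LinearAlgebra.
Variables (K : fieldType) (V : lmodType K).
Implicit Types (M N B : set V) (s : seq V).

Definition submodule M := M 0 /\ forall a u v, M u -> M v -> M (a *: u + v).

(** A submodule maximal among those containing [M] and avoiding [w] is a complement of the line of
    [w]: adjoining a further [v] forces [w] in, and the resulting relation can be solved for [v]. *)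
Lemma maximal_submodule M w : submodule M -> ~ M w ->
  exists N, [/\ M `<=` N, submodule N, ~ N w &
    forall v, exists a, N (v - a *: w)].
Proof.
(* The union with [M] lets the empty chain, whose union is empty, satisfy [P]. *)
move=> sM Mw; pose P := [set A | submodule (A `|` M) /\ ~ (A `|` M) w].
have [|A [[sA Aw] Amax]] := @Zorn_bigcup V P.
  move=> F FP Ftot; split; last first.
    by move=> [[X FX Xw]|//]; have [_] := FP _ FX; apply; left.
  split; first by right; exact: sM.1.
  move=> a u v [[X FX Xu]|Mu] [[Y FY Yv]|Mv].
  - have [XY|YX] := Ftot _ _ FX FY.
      have [] := (FP _ FY).1.2 a u v (or_introl (XY _ Xu)) (or_introl Yv).
        by left; exists Y.
      by right.
    have [] := (FP _ FX).1.2 a u v (or_introl Xu) (or_introl (YX _ Yv)).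
      by left; exists X.
    by right.
  - have [] := (FP _ FX).1.2 a u v (or_introl Xu) (or_intror Mv).
      by left; exists X.
    by right.
  - have [] := (FP _ FY).1.2 a u v (or_intror Mu) (or_introl Yv).
      by left; exists Y.
    by right.
  - by right; exact: sM.2.
exists (A `|` M); split=> // v.
have [Av|nAv] := pselect ((A `|` M) v); first by exists 0; rewrite scale0r subr0.
pose N := [set x | exists u b, (A `|` M) u /\ x = u + b *: v].
have AN : A `|` M `<=` N.
  by move=> x Ax; exists x, 0; rewrite scale0r addr0.
have sN : submodule N.
  split; first by exists 0, 0; rewrite scale0r addr0; split=> //; exact: sA.1.
  move=> a _ _ [x [b [Ax ->]]] [y [c [Ay ->]]].
  exists (a *: x + y), (a * b + c); split; first exact: sA.2.
  by rewrite scalerDr scalerDl scalerA addrACA.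
have Nw : N w.
  apply: contrapT => Nw; apply: (Amax N).
    split=> [x Ax|NA]; first by apply: AN; left.
    apply: nAv; left; apply: NA.
    by exists 0, 1; rewrite scale1r add0r; split=> //; exact: sA.1.
  have NM : N `|` M = N by apply/setUidl => x Mx; apply: AN; right.
  by split; rewrite NM.
have [u [b [Au wE]]] := Nw; have [b0|b0] := eqVneq b 0.
  by exfalso; apply: Aw; rewrite wE b0 scale0r addr0.
exists b^-1; have := sA.2 (- b^-1) u 0 Au sA.1.
by rewrite wE addr0 scalerDr scalerA mulVf // scale1r opprD addrCA subrr addr0 scaleNr.
Qed.

(** Let [psi v] be the scalar [a] with [v - a *: w] in the maximal [N]. It is unique since [w] is
    not in [N], and uniqueness yields linearity and both values. *)
Lemma separating_functional M w : submodule M -> ~ M w ->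
  exists2 psi : linear_map V K^o, forall v, M v -> psi v = 0 & psi w = 1.
Proof.
move=> sM Mw; have [N [MN sN Nw Ndec]] := maximal_submodule sM Mw.
have Nuniq v a b : N (v - a *: w) -> N (v - b *: w) -> a = b.
  move=> Na Nb; apply/eqP; apply: contrapT => /negP; rewrite eq_sym => ab.
  have {Nb}Nb := sN.2 (-1) _ _ Nb Na; apply: Nw.
  have := sN.2 ((b - a)^-1) _ 0 Nb sN.1.
  rewrite scaleN1r opprB addrA subrK -scalerBl scalerA mulVf ?subr_eq0 //.
  by rewrite scale1r addr0.
have /choice[psi psiP] := Ndec.
have lpsi : (psi : V -> K^o) \in @linear_pred K V K^o.
  apply/asboolP => a u v; apply: (Nuniq (a *: u + v)) => //.
  have := sN.2 a _ _ (psiP u) (psiP v).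
  by rewrite scalerBr scalerDl opprD addrACA scalerA.
exists (LinearMap lpsi) => [v Mv|] /=.
  by apply: (Nuniq v) => //; rewrite scale0r subr0; exact: MN.
by apply: (Nuniq w) => //; rewrite scale1r subrr; exact: sN.1.
Qed.

Definition independent B := forall s (c : V -> K), uniq s -> [set` s] `<=` B ->
  \sum_(v <- s) c v *: v = 0 -> forall v, v \in s -> c v = 0.

Lemma hamel_basis_exists : exists B, hamel_basis B.
Proof.
have [|B [iB Bmax]] := @Zorn_bigcup V independent.
  move=> F Find Ftot s c us sF sum0.
  (* A finite list lies in one member of the chain; the empty list is set apart because the chain
     may be empty. *)
  have [->//|[X FX sX]] : s = [::] \/ exists2 X, F X & [set` s] `<=` X.
    elim: s {us sum0} sF => [|v s IH] sF; [by left|right].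
    have [X FX Xv] := sF v (mem_head _ _).
    have [|s0|[Y FY sY]] := IH; first by
      move=> u us; apply: sF; rewrite /= inE us orbT.
      by exists X => //; rewrite s0 => u; rewrite /= inE => /eqP ->.
    have [XY|YX] := Ftot _ _ FX FY.
      exists Y => // u; rewrite /= inE => /orP[/eqP ->|]; first exact: XY.
      exact: sY.
    exists X => // u; rewrite /= inE => /orP[/eqP ->//|us].
    exact/YX/sY.
  exact: Find FX s c us sX sum0.
exists B; split=> // v; have [Bv|nBv] := pselect (B v).
  exists [:: v], (fun=> 1); rewrite big_seq1 scale1r; split=> //.
  by move=> u; rewrite /= inE => /eqP ->.
have : ~ independent (v |` B).
  apply: Bmax; split=> [u Bu|BE]; first by right.
  by apply/nBv/BE; left.
move=> nI; apply: contrapT => nspan; apply: nI => s c us sB.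
have sBr u : u \in rem v s -> B u.
  rewrite mem_rem_uniq // !inE => /andP[uv us'].
  by have [uE|//] := sB u us'; rewrite uE eqxx in uv.
have [vs|vs] := boolP (v \in s); last first.
  move=> sum0; apply: iB => // u us'; have [uE|//] := sB u us'.
  by rewrite /= -uE us' in vs.
rewrite (perm_big _ (perm_to_rem vs)) big_cons /= => sum0.
have [cv|cv] := eqVneq (c v) 0.
  rewrite cv scale0r add0r in sum0.
  move=> u us'; have [->//|uv] := eqVneq u v.
  by apply: iB sum0 _ _; rewrite ?rem_uniq // mem_rem_uniq // !inE uv.
(* A relation with nonzero coefficient at [v] expresses [v] through [B]. *)
case: nspan; exists (rem v s), (fun u => - (c v)^-1 * c u); split=> //.
under eq_bigr do rewrite -scalerA.
rewrite -scaler_sumr; move/eqP: sum0; rewrite addr_eq0 => /eqP sum0.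
by rewrite -[X in - _ *: X]opprK -sum0 scalerN scaleNr opprK scalerA mulVf ?scale1r.
Qed.

End LinearAlgebra.

Lemma hamel_basis_preimage (K : fieldType) (V W : lmodType K)
    (f : {linear V -> W}) (B : set W) :
  bijective f -> hamel_basis B -> hamel_basis (f @^-1` B).
Proof.
move=> [g fK gK] [iB sB]; split=> [s c us sfB sum0|v].
  move=> v vs.
  have := iB (map f s) (c \o g); rewrite (map_inj_uniq (can_inj fK)) => /(_ us).
  rewrite big_map => /(_ _ _ (f v)) /=; rewrite fK; apply.
  - by move=> _ /= /mapP[u us' ->]; exact: sfB.
  - under eq_bigr do rewrite /= fK -linearZ.
    by rewrite -linear_sum sum0 linear0.
  - exact: map_f.
have [s [c [sB' E]]] := sB (f v); exists (map g s), (c \o f); split.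
  by move=> _ /= /mapP[u us ->]; rewrite /= gK; exact: sB'.
apply: (can_inj fK); rewrite E big_map linear_sum; apply: eq_bigr => u _.
by rewrite linearZ /= gK.
Qed.

(** * Functionals on sequences *)

Section SequenceDual.
Variable K : fieldType.
Local Notation dual := (linear_map (nat -> K^o) K^o).
Implicit Types (c w : nat -> K^o).

(** Modulo the eventually zero sequences, a sequence that is eventually 1 equals the constant 1,
    which is not eventually zero and can be separated from them. *)
Lemma exists_limit_functional : exists L : dual,
  forall c N, (forall n, (N <= n)%N -> c n = 1) -> L c = 1.
Proof.
pose M : set (nat -> K^o) := [set c | exists N, forall n, (N <= n)%N -> c n = 0].
have sM : submodule M.
  split=> [|a u v [N uN] [N' vN]]; first by exists 0%N.
  exists (maxn N N') => n; rewrite geq_max => /andP[/uN un /vN vn].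
  by rewrite !fctE un vn scaler0 addr0.
have M1 : ~ M (fun=> 1).
  by move=> [N /(_ N (leqnn N)) /eqP]; rewrite oner_eq0.
have [L LM L1] := separating_functional sM M1.
exists L => c N cN.
have -> : c = (c - (fun=> 1)) + (fun=> 1) by rewrite subrK.
rewrite raddfD /= L1 LM ?add0r //.
by exists N => n /cN; rewrite !fctE => ->; rewrite subrr.
Qed.

(** The [n] linear conditions on the [n.+1] coordinates of the block have a nonzero solution, found
    as a row of the left kernel of [A]. *)
Lemma annihilated_block (phi : nat -> dual) n b : exists w, [/\
  forall i, (i < n)%N -> phi i w = 0,
  exists2 j, (b <= j < b + n.+1)%N & w j != 0 &
  forall m, ~~ (b <= m < b + n.+1)%N -> w m = 0].
Proof.
pose unit_vec m : nat -> K^o := fun k => (k == m)%:R.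
pose A : 'M[K]_(n.+1, n) := \matrix_(i, k) phi k (unit_vec (b + i)%N).
have kA : kermx A != 0.
  rewrite -mxrank_eq0 mxrank_ker subn_eq0 -ltnNge ltnS; exact: rank_leq_col.
have [i0 ri0] : exists i0, row i0 (kermx A) != 0.
  by apply/existsP; apply: contraNT kA => /existsPn r0; apply/eqP/row_matrixP
    => i; have := r0 i; rewrite negbK row0 => /eqP.
set a := row i0 (kermx A) in ri0.
have aA : a *m A = 0 by rewrite -row_mul mulmx_ker row0.
pose w : nat -> K^o := \sum_(i < n.+1) a 0 i *: unit_vec (b + i)%N.
have wE m : w m = \sum_(i < n.+1) a 0 i * (m == (b + i)%N)%:R.
  by rewrite /w fct_sumE.
exists w; split.
- move=> k kn; rewrite /w linear_sum.
  have := congr1 (fun v : 'rV[K]_n => v 0 (Ordinal kn)) aA.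
  rewrite mxE [RHS]mxE => E; rewrite -[RHS]E; apply: eq_bigr => i _.
  by rewrite linearZ /= [A _ _]mxE.
- have [j aj] : exists j, a 0 j != 0.
    by apply/existsP; apply: contraNT ri0 => /existsPn r0; apply/eqP/rowP
      => i; rewrite [RHS]mxE; apply/eqP; rewrite -[_ == _]negbK.
  exists (b + j)%N; first by rewrite leq_addr ltn_add2l ltn_ord.
  rewrite wE (bigD1 j) //= eqxx mulr1 big1 ?addr0 // => i ij.
  by rewrite eqn_add2l eq_sym (inj_eq val_inj) (negPf ij) mulr0.
- move=> m mb; rewrite wE big1 // => i _.
  rewrite (_ : _ == _ = false) ?mulr0 //; apply: contraNF mb => /eqP ->.
  by rewrite leq_addr ltn_add2l ltn_ord.
Qed.

(* [w n] is annihilated by the first [n] functionals and supported in the block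
   [n (n + 1), n (n + 1) + n]; as these blocks are disjoint, a limit functional
   gives [psi] with [psi (w n) = 1] for all [n]. *)
Lemma dual_not_countably_spanned (phi : nat -> dual) : exists psi : dual,
  forall N, exists2 w, forall i, (i < N)%N -> phi i w = 0 & psi w != 0.
Proof.
have /choice[w wP] := fun n => annihilated_block phi n (n * n.+1).
have /choice[j jP] : forall n, exists j,
    (n * n.+1 <= j < n * n.+1 + n.+1)%N /\ w n j != 0.
  by move=> n; have [_ [j ? ?] _] := wP n; exists j.
have wj n m : n != m -> w n (j m) = 0.
  move=> nm; have [_ _ ->] := wP n => //.
  (* Different blocks are disjoint, since [n * n.+1 + n < n.+1 * n.+2]. *)
  have [jm _] := jP m; apply: contraNN nm => jn; apply/eqP; nia.
have [L L1] := exists_limit_functional.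
(* On [w N] only [m = N] contributes, so [T (w N)] is 0 before [N] and 1 from [N] on. *)
pose T (v : nat -> K^o) : nat -> K^o := fun n => \sum_(m < n.+1) v (j m) / w m (j m).
have lpsi : (fun v => L (T v)) \in @linear_pred K (nat -> K^o) K^o.
  apply/asboolP => a u v.
  have -> : T (a *: u + v) = a *: T u + T v.
    apply/funext => n; rewrite /T !fctE /GRing.scale /= mulr_sumr -big_split /=.
    by apply: eq_bigr => m _; rewrite mulrDl mulrA.
  by rewrite linearP.
exists (LinearMap lpsi) => N; exists (w N); first by have [] := wP N.
rewrite /= (L1 _ N) ?oner_neq0 // => n Nn.
have Nn1 : (N < n.+1)%N by [].
rewrite /T (bigD1 (Ordinal Nn1)) //= divff ?(jP N).2 // big1 ?addr0 // => m mN.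
by rewrite wj ?mul0r // eq_sym.
Qed.

End SequenceDual.

(** * Dimensions and strictness of the inclusion *)

Section Dimensions.
Variable R : realType.

Local Notation X := (bouquet R).
Local Notation O := (wedge_point R).

(** For every [N] the limit functional is 1 on [N] zeros followed by ones, against
    [smooth_derivation_tail]. *)
Lemma limit_functional_not_smooth :
  exists D : right_tangent O, D \notin @smooth_derivation R X O.
Proof.
have [L L1] := exists_limit_functional R.
exists (tangent_of_dual L); apply/negP => /smooth_derivation_tail[N LN].
have := LN (fun n => (N <= n)%:R); rewrite /= slope_lin (L1 _ N) => [H|n ->] //.
have /eqP : 1 = 0 :> R by apply: H => n nN; rewrite leqNgt nN.
by rewrite oner_eq0.
Qed.

Lemma direct_sum_basis (K : fieldType) (e : nat -> direct_sum K nat) :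
  (forall n m, e n m = (m == n)%:R) -> hamel_basis (range e).
Proof.
move=> eE; split=> [s c us sE sum0 x xs|v].
  have [n _ xE] := sE x xs; rewrite -{}xE in xs *.
  have : (\sum_(v <- s) c v *: v) n = 0 by rewrite sum0.
  have -> : (\sum_(v <- s) c v *: v) n = \sum_(v <- s) c v * v n.
    by elim/big_rec2 : _ => // i y F _ <-.
  rewrite (bigD1_seq (e n)) //= eE eqxx mulr1 big_seq_cond big1 ?addr0 //.
  move=> u /andP[us' un]; have [m _ um] := sE u us'; rewrite -um eE.
  case: eqP => [nm|]; last by rewrite mulr0.
  by rewrite -um nm eqxx in un.
have [r rP] : exists r : seq nat, forall n, v n != 0 -> n \in r.
  have /asboolP/finite_seqP[s sE] := direct_sumP v.
  by exists s => n vn; have : [set i | v i != 0] n by []; rewrite sE.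
have ei : injective e.
  move=> n m /(congr1 (fun u : direct_sum K nat => u n)); rewrite !eE eqxx.
  by case: eqP => // _ /eqP; rewrite oner_eq0.
have /choice[k kE] : forall u : direct_sum K nat, exists k, forall n, u = e n -> k = n.
  move=> u; have [[n uE]|nu] := pselect (exists n, u = e n).
    by exists n => m; rewrite uE => /ei.
  by exists 0%N => n uE; case: nu; exists n.
exists (map e (undup r)), (fun u => v (k u)); split.
  by move=> _ /= /mapP[n _ ->]; exists n.
apply/val_inj/funext => n; rewrite big_map.
have -> : \val (\sum_(i <- undup r) v (k (e i)) *: e i) n =
    \sum_(i <- undup r) v i * e i n.
  elim/big_rec2 : _ => // i x F _ <-.
  by rewrite (kE (e i) i).
have [nr|nr] := boolP (n \in undup r).
  rewrite (bigD1_seq n) ?undup_uniq //= eE eqxx mulr1 big1 ?addr0 // => i ni.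
  by rewrite eE eq_sym (negPf ni) mulr0.
rewrite big1_seq => [|i /= ir]; last first.
  by rewrite eE; case: eqP => [E|_]; [rewrite E ir in nr|rewrite mulr0].
by apply/eqP; apply: contraNT nr => /rP; rewrite mem_undup.
Qed.

Lemma dim_external_tangent : dim_eq (external_tangent O) [set: nat].
Proof.
have eP n : (fun m => (m == n)%:R) \in @finsupp_pred R nat.
  apply/asboolP; apply: sub_finite_set (finite_set1 n) => m /=.
  by rewrite pnatr_eq0 eqb0 negbK => /eqP.
pose e n : direct_sum R nat := DirectSum (eP n).
have [g fK gK] := @sum_of_external_bij R.
exists (@sum_of_external R @^-1` range e).
  apply: hamel_basis_preimage; last exact: direct_sum_basis.
  exact: sum_of_external_bij.
have -> : @sum_of_external R @^-1` range e = [set g (e n) | n in [set: nat]].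
  apply/seteqP; split=> [D [n _ nD]|_ [n _ <-]].
    by exists n => //; rewrite nD fK.
  by exists n => //; rewrite gK.
apply: inj_card_eq => n m _ _ /(can_inj gK).
move=> /(congr1 (fun u : direct_sum R nat => u n)) /=; rewrite eqxx.
by case: eqP => // _ /eqP; rewrite oner_eq0.
Qed.

(** If a Hamel basis were countable, the functional of [dual_not_countably_spanned] would be a
    combination of the first [N] members of an enumeration, yet it is nonzero on some [w] that they
    annihilate. *)
Lemma dim_right_tangent : dim_gt (right_tangent O) [set: nat].
Proof.
have [B BH] := hamel_basis_exists (right_tangent O).
(* An uncountable set is infinite, so [nat] injects into it: both conditions of [dim_gt] follow. *)
suff nB : ~ countable B.
  exists B => //; apply/andP; split; last exact/negP.
  by apply/infiniteP => /finite_set_countable.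
move=> /countable_injP[f fi].
have /choice[phi phiE] : forall k, exists phi : linear_map (nat -> R^o) R^o,
    forall D, B D -> f D = k -> phi = dual_of_tangent D.
  move=> k; have [[D [BD fD]]|nD] := pselect (exists D, B D /\ f D = k).
    exists (dual_of_tangent D) => E BE fE; congr dual_of_tangent.
    by apply: fi; rewrite ?inE // fD.
  by exists 0 => D BD fD; case: nD; exists D.
have [psi psiP] := dual_not_countably_spanned phi.
have [s [c [sB psiE]]] := BH.2 (tangent_of_dual psi).
have [w w0 /eqP] := psiP (\max_(D <- s) (f D).+1); apply.
rewrite -(tangent_of_dualK psi) psiE linear_sum.
have -> : (\sum_(D <- s) dual_of_tangent (c D *: D)) w =
    \sum_(D <- s) c D * dual_of_tangent D w.
  by elim/big_rec2 : _ => // D x F _ <-.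
rewrite big1_seq // => D /andP[_ Ds].
rewrite -(phiE _ _ (sB _ Ds) erefl) w0 ?mulr0 //.
exact: (leq_bigmax_seq (F := fun D => (f D).+1)).
Qed.

End Dimensions.

Theorem theorem3p1 (R : realType) :
  [/\ exists phi : {linear external_tangent (wedge_point R)
                           -> direct_sum R nat}, bijective phi,
      exists phi : {linear right_tangent (wedge_point R)
                           -> linear_map (nat -> R^o) R^o}, bijective phi,
      dim_eq (external_tangent (wedge_point R)) [set: nat],
      dim_gt (right_tangent (wedge_point R)) [set: nat] &
      [set` @smooth_derivation R (bouquet R) (wedge_point R)] <>
        [set: right_tangent (wedge_point R)]].
Proof.
split.
- by exists (@sum_of_external R); exact: sum_of_external_bij.
- exists (@dual_of_tangent R); exists (@tangent_of_dual R).
    exact: dual_of_tangentK.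
  exact: tangent_of_dualK.
- exact: dim_external_tangent.
- exact: dim_right_tangent.
- move=> E; have [D /negP] := limit_functional_not_smooth R; apply.
  by have : [set: right_tangent (wedge_point R)] D by []; rewrite -E.
Qed.
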